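(* There is a random variable $\Psi\ge0$ such that for all $s\in[0,1]$, $$Z(s)\stackrel d=(s(1-s))^{\beta/2}\,\Psi.$$ The distribution of $\Psi$ is characterized by its moments $c_m:=\mathbf E[\Psi^m]$, $m\in\mathbb N$. They are given by $c_1=1$ and the recurrence $$c_m=\frac{\beta m+1}{(m-1)\left(m+1-\frac32\beta m\right)}\sum_{\ell=1}^{m-1}\binom m\ell\,\mathrm B(\beta\ell+1,\beta(m-\ell)+1)\,c_\ell\,c_{m-\ell},\qquad m\ge2.$$
   Context: $\mathrm B(a,b)=\int_0^1x^{a-1}(1-x)^{b-1}\,dx$ for $a,b>0$, and $\beta=\frac{\sqrt{17}-3}{2}$. $Z=(Z(s),s\in[0,1])$ is the random continuous function on $[0,1]$ arising as the distributional limit of rescaled partial match costs in random quadtrees. It exists, and its distribution is the unique one (among random elements of the space $\mathcal D[0,1]$ of càdlàg functions with supremum norm $\|\cdot\|$) with $\mathbf E[Z(s)]=(s(1-s))^{\beta/2}$ for all $s\in[0,1]$ and $\mathbf E[\|Z\|^2]<\infty$ satisfying $$\begin{aligned}Z(s)\stackrel{d}{=}\ &\mathbf 1_{\{s<U\}}\left[(UV)^\beta Z^{(1)}\!\left(\tfrac sU\right)+(U(1-V))^\beta Z^{(2)}\!\left(\tfrac sU\right)\right]\\&+\mathbf 1_{\{s\ge U\}}\left[((1-U)V)^\beta Z^{(3)}\!\left(\tfrac{s-U}{1-U}\right)+((1-U)(1-V))^\beta Z^{(4)}\!\left(\tfrac{s-U}{1-U}\right)\right]\end{aligned}$$ as processes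 in $s\in[0,1]$, where $U,V$ are independent uniform random variables on $[0,1]$ and $Z^{(1)},\dots,Z^{(4)}$ are independent copies of $Z$, independent of $(U,V)$. *)

(* Defs.v *)
From HB Require Import structures.
From mathcomp Require Import all_boot all_order all_algebra.
From mathcomp Require Import finmap.
From mathcomp Require Import all_classical all_reals all_analysis.

Set Implicit Arguments.
Unset Strict Implicit.
Unset Printing Implicit Defensive.

Import Order.TTheory GRing.Theory Num.Theory.
Import numFieldNormedType.Exports.

Local Open Scope classical_set_scope.
Local Open Scope ring_scope.

Definition beta_exp (R : realType) : R := (Num.sqrt 17 - 3) / 2.

(* Euler's Beta function with real arguments; the library's [beta_fun] takes
   natural numbers only. *)
Definition Beta (R : realType) (a b : R) : R :=
  \int[lebesgue_measure]_(x in `[0, 1]) (x `^ (a - 1) * (1 - x) `^ (b - 1)).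

(* Equality in law tested on a set system [G] of the state space: the Borel sets
   for real random variables, [cylinder] for processes. *)
Definition eq_law (R : realType) (E : Type) (G : set (set E))
    (d1 : measure_display) (T1 : measurableType d1) (P1 : probability T1 R)
    (X1 : T1 -> E)
    (d2 : measure_display) (T2 : measurableType d2) (P2 : probability T2 R)
    (X2 : T2 -> E) : Prop :=
  forall A, G A -> P1 (X1 @^-1` A) = P2 (X2 @^-1` A).

(* The sigma-algebra generated by the evaluations at the points of [0, 1].
   Its trace on the cadlag functions on [0, 1] is the Skorokhod-Borel
   sigma-algebra, and its trace on C[0, 1] is the Borel sigma-algebra of the
   supremum norm.  Paths are functions on R, but their values outside [0, 1]
   are irrelevant. *)
Definition cylinder (R : realType) : set (set (R -> R)) :=
  <<s [set C | exists2 s : R, s \in `[0, 1] &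
         exists2 B : set R, measurable B & C = [set f : R -> R | B (f s)]] >>.

Definition path_of (R : realType) (d : measure_display) (T : measurableType d)
    (P : probability T R) (Z : R -> {RV P >-> R}) (w : T) : R -> R :=
  fun s => Z s w.

(* A random element of C[0, 1]: measurability is part of [Z s : {RV P >-> R}]. *)
Definition continuous_process (R : realType) (d : measure_display)
    (T : measurableType d) (P : probability T R) (Z : R -> {RV P >-> R}) : Prop :=
  forall w, {within `[0, 1], continuous (path_of Z w)}.

(* [sup] is the actual supremum only for bounded f, e.g. f continuous on
   [0, 1]. *)
Definition sup_norm (R : realType) (f : R -> R) : R :=
  sup [set `|f s| | s in `[0, 1]].

Definition mutually_independent (R : realType) (d : measure_display)
    (T : measurableType d) (P : probability T R) (I : choiceType)
    (F : I -> set (set T)) : Prop :=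
  forall (J : {fset I}) (E : I -> set T),
    (forall i, i \in J -> F i (E i)) ->
    P (\bigcap_(i in [set` J]) E i) = (\prod_(i <- J) P (E i))%E.

Definition uniform01 (R : realType) (d : measure_display)
    (T : measurableType d) (P : probability T R) (U : {RV P >-> R}) : Prop :=
  forall A : set R, measurable A ->
    distribution P U A = uniform_prob (@ltr01 R) A.

(* The four copies are indexed from 0. *)
Definition rde_rhs (R : realType) (u v : R) (z : 'I_4 -> R -> R) (s : R) : R :=
  let b := beta_exp R in
  if s < u then
    (u * v) `^ b * z 0 (s / u) + (u * (1 - v)) `^ b * z 1 (s / u)
  else
    ((1 - u) * v) `^ b * z 2 ((s - u) / (1 - u))
    + ((1 - u) * (1 - v)) `^ b * z 3 ((s - u) / (1 - u)).

(* The sigma-algebras generated by U, by V and by each of the processes. *)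
Definition rde_sigmas (R : realType) (d : measure_display)
    (T : measurableType d) (P : probability T R) (U V : {RV P >-> R})
    (Zc : 'I_4 -> R -> {RV P >-> R}) (i : bool + 'I_4) : set (set T) :=
  match i with
  | inl true => preimage_set_system setT U measurable
  | inl false => preimage_set_system setT V measurable
  | inr k => preimage_set_system setT (path_of (Zc k)) (@cylinder R)
  end.

(* The right-hand side of the equation is realized on an auxiliary probability
   space carrying (U, V) and the independent copies, which are again random
   elements of C[0, 1]. *)
Definition solves_rde (R : realType) (d : measure_display)
    (T : measurableType d) (P : probability T R) (Z : R -> {RV P >-> R}) : Prop :=
  exists (d' : measure_display) (T' : measurableType d')
    (P' : probability T' R) (U V : {RV P' >-> R})
    (Zc : 'I_4 -> R -> {RV P' >-> R}),
    [/\ uniform01 U, uniform01 V,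
        mutually_independent P' (rde_sigmas U V Zc),
        (forall k, continuous_process (Zc k) /\
           eq_law (@cylinder R) P' (path_of (Zc k)) P (path_of Z))
      & eq_law (@cylinder R) P (path_of Z)
          P' (fun w => rde_rhs (U w) (V w) (fun k => path_of (Zc k) w))].

Definition has_moments (R : realType) (d : measure_display)
    (T : measurableType d) (P : probability T R) (X : {RV P >-> R}) : Prop :=
  forall m : nat, P.-integrable setT (fun w => (X w ^+ m)%:E).

(* [fine] loses nothing under [has_moments]. *)
Definition moment (R : realType) (d : measure_display)
    (T : measurableType d) (P : probability T R) (X : {RV P >-> R})
    (m : nat) : R :=
  fine 'E_P[fun w => X w ^+ m].

(* Determinacy among all laws on the real line, not only those on [0, +oo[. *)
Definition characterized_by_moments (R : realType) (d : measure_display)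
    (T : measurableType d) (P : probability T R) (X : {RV P >-> R}) : Prop :=
  has_moments X /\
  forall (d' : measure_display) (T' : measurableType d')
    (P' : probability T' R) (Y : {RV P' >-> R}),
    has_moments Y -> (forall m : nat, moment Y m = moment X m) ->
    eq_law (@measurable _ R) P' Y P X.

(* Main.v *)
Require Import Defs.
From HB Require Import structures.
From mathcomp Require Import all_boot all_order all_algebra.
From mathcomp Require Import finmap.
From mathcomp Require Import all_classical all_reals all_analysis.
From mathcomp Require Import measurable_realfun ring lra.
Import Order.TTheory GRing.Theory Num.Theory.
Import numFieldNormedType.Exports.
Local Open Scope classical_set_scope.
Local Open Scope ring_scope.

Set Implicit Arguments.
Unset Strict Implicit.
Unset Printing Implicit Defensive.

(** Write b for the exponent, h(s) = (s (1 - s))^(b/2), and rho, tau for the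
    length of the interval ([0, U] or [U, 1]) that contains s and for the
    relative position of s in it. Given U, the right-hand side of the equation
    at s is rho^b (V^b X + (1 - V)^b Y), where X and Y are independent copies of
    Z(tau). Expanding the m-th power gives a recursion for the moments,

      E Z(s)^m = E[ rho^(b m) sum_l C(m, l) B(b l + 1, b (m - l) + 1)
                    E Z(tau)^l E Z(tau)^(m - l) ]          (moment_rde),

    where the expectation is over U and the inner moments are taken at fixed
    tau.

    The powers of h are eigenfunctions of f |-> E[ rho^(b m) f(tau) ]: since
    rho^2 tau (1 - tau) is s (U - s) or (1 - s) (s - U), the function h^m is
    multiplied by 1 / (b m / 2 + 1) (integral_rde_profileX). Suppose that
    E Z(s)^l = c_l h(s)^l for l < m. Then c_m h^m solves the recursion at order m
    exactly when c_m satisfies the stated recurrence, because b^2 + 3 b = 2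
    (rec_rhs_fixpoint). It is the only bounded solution for m >= 2, because the
    terms that contain the m-th moment, l = 0 and l = m, contribute a
    contraction of ratio 2 / (b m + 1) < 1 (moment_profile_step). For m = 1
    the formula is the assumption on the mean. Hence Z(s) has the moments of
    h(s) X, where X = Z(1/2) / h(1/2).

    Three points remain.

    All moments must exist and be bounded in s (bounded_moments). The same
    contraction proves it, applied to x^p min(x, K) in place of x^(p+1), with
    constants that do not depend on K.

    Moments must determine the law. Since C(m, l)^b B(b l + 1, b (m - l) + 1) <= 1
    the recurrence gives c_m <= 10^m (m!)^(1 - b) / 10 (rec_growth). As
    1 - b < 1/2, X has Gaussian exponential moments of every order
    (gauss_criterion), so that E exp(-(p + q X)^2) is the limit of the
    expectations of its Taylor polynomials, and these Gaussian functionals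
    determine the distribution function (moment_determinacy).

    Psi must be nonnegative. At m = 1 the operator has eigenvalue exactly 1, so
    the triangle inequality for |Z(s)| in the equation is an equality in mean,
    hence almost surely. Comparing second moments then gives E|X| = 1 = E X
    (abs_moment_one), so X = |X| almost surely, and Psi = |X|. *)

(** * The exponent and integrals of powers *)

Lemma integral_probability_cst (R : realType) d (T : measurableType d)
    (P : probability T R) (c : R) : (\int[P]_w (cst c%:E w) = c%:E)%E.
Proof. by have := @expectation_cst _ _ _ P c; rewrite unlock. Qed.

Lemma uniform_prob_unit (R : realType) :
  uniform_prob (@ltr01 R) `[0, 1]%classic = 1%E.
Proof. exact: integral_uniform_pdf1. Qed.

Lemma beta_exp_bounds (R : realType) : 1 / 2 < beta_exp R < 3 / 5.
Proof.
have s0 : 0 <= Num.sqrt 17 :> R by rewrite sqrtr_ge0.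
have s2 : Num.sqrt 17 ^+ 2 = 17 :> R by rewrite sqr_sqrtr.
rewrite /beta_exp; move: s0 s2; set q := Num.sqrt 17 => s0; rewrite expr2 => s2.
by apply/andP; split; nra.
Qed.

Lemma beta_exp_ge0 (R : realType) : 0 <= beta_exp R.
Proof. by have /andP[] := beta_exp_bounds R; lra. Qed.

Lemma beta_exp_root (R : realType) : beta_exp R ^+ 2 + 3 * beta_exp R = 2.
Proof.
have s2 : Num.sqrt 17 ^+ 2 = 17 :> R by rewrite sqr_sqrtr.
by rewrite /beta_exp; move: s2; set q := Num.sqrt 17; rewrite !expr2 => s2; lra.
Qed.

Lemma powR_exprn (R : realType) (x b : R) (n : nat) :
  (x `^ b) ^+ n = x `^ (b * n%:R).
Proof. by rewrite powRrM powR_mulrn// powR_ge0. Qed.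

Lemma powR_le1 (R : realType) (x b : R) : 0 <= x <= 1 -> 0 <= b -> x `^ b <= 1.
Proof.
move=> /andP[x0 x1] b0; have e1 : 1 `^ b = 1 :> R by rewrite powR1.
rewrite -e1.
by apply: ge0_ler_powR => //; rewrite nnegrE ?ler01.
Qed.

Lemma powR_near0 (R : realType) (a e : R) : 0 < a -> 0 < e ->
  exists2 d : R, 0 < d & forall y, 0 <= y < d -> y `^ a < e.
Proof.
move=> a0 e0; exists (e `^ a^-1); first exact: powR_gt0.
move=> y /andP[y0 yd].
have -> : e = (e `^ a^-1) `^ a by rewrite -powRrM mulVf ?gt_eqF// powRr1// ltW.
by apply: gt0_ltr_powR => //; rewrite nnegrE// powR_ge0.
Qed.

Lemma cvg_powR_at_right (R : realType) (a c : R) : 0 < a ->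
  (x - c) `^ a @[x --> c^'+] --> 0.
Proof.
move=> a0; apply/cvgrPdist_lt => e e0; have [d d0 dP] := powR_near0 a0 e0.
near=> x; rewrite sub0r normrN ger0_norm ?powR_ge0//; apply: dP.
rewrite subr_ge0 ltrBlDl; apply/andP; split.
  by rewrite ltW//; near: x; exact: nbhs_right_gt.
by near: x; apply: nbhs_right_lt; rewrite ltrDl.
Unshelve. all: by end_near. Qed.

Lemma cvg_powR_at_left (R : realType) (a c : R) : 0 < a ->
  (c - x) `^ a @[x --> c^'-] --> 0.
Proof.
move=> a0; apply/cvgrPdist_lt => e e0; have [d d0 dP] := powR_near0 a0 e0.
near=> x; rewrite sub0r normrN ger0_norm ?powR_ge0//; apply: dP.
rewrite subr_ge0 ltrBlDl -ltrBlDr; apply/andP; split.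
  by rewrite ltW//; near: x; exact: nbhs_left_lt.
by near: x; apply: nbhs_left_gt; rewrite ltrBlDr ltrDl.
Unshelve. all: by end_near. Qed.

Lemma is_derive_powR_subl (R : realType) (a c x : R) : c < x ->
  is_derive x 1 (fun y => (y - c) `^ a) (a * (x - c) `^ (a - 1)).
Proof.
move=> cx.
have h1 : is_derive x 1 (fun y : R => y - c) 1.
  by apply: is_derive_eq; rewrite subr0.
have h2 : is_derive (x - c) 1 (fun y : R => y `^ a) (a * (x - c) `^ (a - 1)).
  by apply: is_derive1_powR; rewrite subr_gt0.
by have := is_derive1_comp (g := fun y => y - c) (f := fun y => y `^ a) h2 h1; rewrite mulr1.
Qed.

Lemma is_derive_powR_subr (R : realType) (a c x : R) : x < c ->
  is_derive x 1 (fun y => (c - y) `^ a) (- (a * (c - x) `^ (a - 1))).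
Proof.
move=> cx.
have h1 : is_derive x 1 (fun y : R => c - y) (-1).
  by apply: is_derive_eq; rewrite add0r mul1r.
have h2 : is_derive (c - x) 1 (fun y : R => y `^ a) (a * (c - x) `^ (a - 1)).
  by apply: is_derive1_powR; rewrite subr_gt0.
by have := is_derive1_comp (g := fun y => c - y) (f := fun y => y `^ a) h2 h1; rewrite mulrN1.
Qed.

Lemma integral_powR_subl (R : realType) (a c e : R) : 0 < a -> c < e ->
  (\int[lebesgue_measure]_(x in `[c, e]) ((x - c) `^ a)%:E =
   ((e - c) `^ (a + 1) / (a + 1))%:E)%E.
Proof.
move=> a0 ce; have a1 : 0 < a + 1 by rewrite addr_gt0.
have dF (b : R) x : c < x -> derivable (fun y => (y - c) `^ b) x 1.
  by move=> cx; have [] := is_derive_powR_subl b cx.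
have cF (b : R) x : c < x -> {for x, continuous (fun y => (y - c) `^ b)}.
  by move=> cx; apply: differentiable_continuous; apply/derivable1_diffP; exact: dF.
pose F x := (a + 1)^-1 * (x - c) `^ (a + 1).
rewrite (@continuous_FTC2 _ _ F)//.
- by rewrite /F subrr powR0 ?gt_eqF// mulr0 sube0 mulrC.
- apply/continuous_within_itvP => //; split.
  + by move=> x; rewrite in_itv/= => /andP[cx _]; exact: cF.
  + by rewrite subrr powR0 ?gt_eqF//; exact: cvg_powR_at_right.
  + by apply: cvg_at_left_filter; exact: cF.
- split.
  + move=> x; rewrite in_itv/= => /andP[cx _]; apply: derivableM => //.
    exact: dF.
  + rewrite /F subrr powR0 ?gt_eqF//; apply: cvgM; first exact: cvg_cst.
    exact: cvg_powR_at_right.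
  + apply: cvg_at_left_filter; apply: cvgM; first exact: cvg_cst.
    exact: cF.
- move=> x; rewrite in_itv/= => /andP[cx _].
  have h := is_derive_powR_subl (a + 1) cx.
  rewrite derive1E deriveZ//.
  by rewrite derive_val addrK /GRing.scale/= mulrA mulVf ?mul1r ?gt_eqF.
Qed.

Lemma integral_powR_subr (R : realType) (a c e : R) : 0 < a -> c < e ->
  (\int[lebesgue_measure]_(x in `[c, e]) ((e - x) `^ a)%:E =
   ((e - c) `^ (a + 1) / (a + 1))%:E)%E.
Proof.
move=> a0 ce; have a1 : 0 < a + 1 by rewrite addr_gt0.
have dF (b : R) x : x < e -> derivable (fun y => (e - y) `^ b) x 1.
  by move=> cx; have [] := is_derive_powR_subr b cx.
have cF (b : R) x : x < e -> {for x, continuous (fun y => (e - y) `^ b)}.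
  by move=> cx; apply: differentiable_continuous; apply/derivable1_diffP; exact: dF.
pose F x := - (a + 1)^-1 * (e - x) `^ (a + 1).
rewrite (@continuous_FTC2 _ _ F)//.
- by rewrite /F subrr powR0 ?gt_eqF// mulr0 sub0e mulNr EFinN oppeK mulrC.
- apply/continuous_within_itvP => //; split.
  + by move=> x; rewrite in_itv/= => /andP[_ xe]; exact: cF.
  + by apply: cvg_at_right_filter; exact: cF.
  + by rewrite subrr powR0 ?gt_eqF//; exact: cvg_powR_at_left.
- split.
  + move=> x; rewrite in_itv/= => /andP[_ xe]; apply: derivableM => //.
    exact: dF.
  + apply: cvg_at_right_filter; apply: cvgM; first exact: cvg_cst.
    exact: cF.
  + rewrite /F subrr powR0 ?gt_eqF//; apply: cvgM; first exact: cvg_cst.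
    exact: cvg_powR_at_left.
- move=> x; rewrite in_itv/= => /andP[_ xe].
  have h := is_derive_powR_subr (a + 1) xe.
  rewrite derive1E deriveZ//.
  by rewrite derive_val addrK /GRing.scale/= mulrNN mulrA mulVf ?mul1r ?gt_eqF.
Qed.

Lemma integral_powR_subl_le (R : realType) (a c e : R) : 0 < a -> c <= e ->
  (\int[lebesgue_measure]_(x in `[c, e]) ((x - c) `^ a)%:E =
   ((e - c) `^ (a + 1) / (a + 1))%:E)%E.
Proof.
move=> a0; rewrite le_eqVlt => /orP[/eqP <-|]; last exact: integral_powR_subl.
by rewrite set_itv1 integral_set1 subrr powR0 ?mul0r// gt_eqF// addr_gt0.
Qed.

Lemma integral_powR_subr_le (R : realType) (a c e : R) : 0 < a -> c <= e ->
  (\int[lebesgue_measure]_(x in `[c, e]) ((e - x) `^ a)%:E =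
   ((e - c) `^ (a + 1) / (a + 1))%:E)%E.
Proof.
move=> a0; rewrite le_eqVlt => /orP[/eqP <-|]; last exact: integral_powR_subr.
by rewrite set_itv1 integral_set1 subrr powR0 ?mul0r// gt_eqF// addr_gt0.
Qed.

Lemma Beta_ge0 (R : realType) (a b : R) : 0 <= Beta a b.
Proof. by apply: Rintegral_ge0 => x _; rewrite mulr_ge0 ?powR_ge0. Qed.

Lemma Beta_uniform (R : realType) (x y : R) : 0 <= x -> 0 <= y ->
  (uniform_prob (@ltr01 R)).-integrable setT (fun v => (v `^ x * (1 - v) `^ y)%:E) /\
  (\int[uniform_prob (@ltr01 R)]_v (v `^ x * (1 - v) `^ y)%:E =
   (Beta (x + 1) (y + 1))%:E)%E.
Proof.
move=> x0 y0; pose k v : R := v `^ x * (1 - v) `^ y.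
have k0 v : 0 <= k v by rewrite mulr_ge0 ?powR_ge0.
have mk : measurable_fun setT (EFin \o k).
  apply/measurable_EFinP; apply: measurable_funM; first exact: measurable_powR.
  apply: (measurableT_comp (@measurable_powR R y)).
  exact: measurable_funB.
have E : (\int[uniform_prob (@ltr01 R)]_v (k v)%:E =
    \int[lebesgue_measure]_(v in `[0%R, 1%R]) (k v)%:E)%E.
  by rewrite integral_uniform//= subr0 invr1 mul1e.
have le1 : (\int[lebesgue_measure]_(v in `[0%R, 1%R]) (k v)%:E <= 1%:E)%E.
  apply: (@le_trans _ _ (\int[lebesgue_measure]_(v in `[0%R, 1%R]) (cst 1%:E v))%E).
    apply: ge0_le_integral => //.
    - by move=> v _; rewrite lee_fin.
    - exact: measurable_funTS.
    - move=> v /=; rewrite in_itv/= => /andP[v0 v1]; rewrite lee_fin.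
      by rewrite mulr_ile1 ?powR_ge0// powR_le1// ?v0 ?v1// ?subr_ge0 ?v1// gerBl.
  by rewrite integral_cst//= lebesgue_measure_itv/= lte_fin ltr01 oppr0 adde0 mul1e.
have fin : (\int[lebesgue_measure]_(v in `[0%R, 1%R]) (k v)%:E)%E \is a fin_num.
  rewrite ge0_fin_numE; first exact: le_lt_trans le1 (ltry 1).
  by apply: integral_ge0 => v _; rewrite lee_fin.
split.
  apply/integrableP; split => //.
  under eq_integral do rewrite gee0_abs ?lee_fin ?mulr_ge0 ?powR_ge0//.
  by rewrite E; exact: le_lt_trans le1 (ltry 1).
rewrite E /Beta !addrK /Rintegral fineK//.
Qed.

Lemma Beta_1r (R : realType) (a : R) : 0 < a -> Beta (a + 1) 1 = (a + 1)^-1.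
Proof.
move=> a0; rewrite /Beta addrK subrr /Rintegral.
under eq_integral do rewrite powRr0 mulr1.
under eq_integral => x _ do rewrite -[x in x `^ _]subr0.
by rewrite integral_powR_subl// subr0 powR1 div1r.
Qed.

Lemma Beta_1l (R : realType) (a : R) : 0 < a -> Beta 1 (a + 1) = (a + 1)^-1.
Proof.
move=> a0; rewrite /Beta addrK subrr /Rintegral.
under eq_integral do rewrite powRr0 mul1r.
by rewrite integral_powR_subr// subr0 powR1 div1r.
Qed.

(** * Laws determined by their moments *)

Lemma integral_EFin_moment (R : realType) d (T : measurableType d)
    (P : probability T R) (X : {RV P >-> R}) (m : nat) :
  has_moments X -> (\int[P]_w (X w ^+ m)%:E)%E = (moment X m)%:E.
Proof.
move=> hX; rewrite /moment unlock fineK//.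
exact: integrable_fin_num (hX m).
Qed.

Lemma integral_horner (R : realType) d (T : measurableType d)
    (P : probability T R) (X : {RV P >-> R}) (p : {poly R}) :
  has_moments X ->
  (\int[P]_w (p.[X w])%:E)%E = (\sum_(i < size p) p`_i * moment X i)%:E.
Proof.
move=> hX.
under eq_integral do rewrite horner_coef -sumEFin.
rewrite integral_sum//; last first.
  by move=> i; under eq_fun do rewrite EFinM; exact: integrableZl.
rewrite -sumEFin; apply: eq_bigr => i _.
under eq_integral do rewrite EFinM.
by rewrite integralZl// integral_EFin_moment.
Qed.

Lemma nneseries_expR (R : realType) (x : R) : 0 <= x ->
  (\sum_(n <oo) (x ^+ n / n`!%:R)%:E)%E = (expR x)%:E.
Proof.
move=> x0; rewrite /expR -EFin_lim; last exact: is_cvg_series_exp_coeff.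
by congr (limn _); apply/funext => n; rewrite /= /series/= sumEFin.
Qed.

Lemma series_exp_coeff_le (R : realType) (x : R) n :
  `|series (exp_coeff x) n| <= expR `|x|.
Proof.
apply: le_trans (ler_norm_sum _ _ _) _.
apply: le_trans (nondecreasing_cvgn_le _ (is_cvg_series_exp_coeff `|x|) n).
  apply: ler_sum => i _; rewrite /exp_coeff/= normrM normrX normfV.
  by rewrite (ger0_norm (ler0n _ _)).
apply: nondecreasing_series => i _ _.
by rewrite /exp_coeff/= divr_ge0.
Qed.

(** The partial sums are the expectations of the partial sums of the exponential
    series of a X^2, which increase to it. *)
Lemma expR_sqr_lty (R : realType) d (T : measurableType d)
    (P : probability T R) (X : {RV P >-> R}) (a B : R) :
  has_moments X -> 0 <= a ->
  (forall n, \sum_(0 <= j < n) a ^+ j / j`!%:R * moment X (j.*2) <= B) ->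
  (\int[P]_w (expR (a * X w ^+ 2))%:E < +oo)%E.
Proof.
move=> hX a0 XB.
have mX : measurable_fun setT X by [].
under eq_integral => w _ do
  rewrite -(nneseries_expR (mulr_ge0 a0 (sqr_ge0 (X w)))).
rewrite integral_nneseries//; last 2 first.
- move=> n; apply/measurable_EFinP; apply: measurable_funM => //.
  by apply: measurable_funX; apply: measurable_funM => //; exact: measurable_funX.
- by move=> n w _; rewrite lee_fin divr_ge0// exprn_ge0// mulr_ge0// sqr_ge0.
apply: le_lt_trans (ltry B).
rewrite [X in (X <= _)%E](_ : _ =
    \sum_(n <oo) (a ^+ n / n`!%:R * moment X n.*2)%:E)%E; last first.
  apply: eq_eseriesr => n _.
  under eq_integral => w _ do rewrite exprMn -exprM mul2n mulrAC EFinM.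
  by rewrite integralZl ?integral_EFin_moment//; exact: hX.
apply: lime_le.
  apply: is_cvg_ereal_nneg_natsum_cond => n _ _.
  rewrite lee_fin mulr_ge0 ?divr_ge0 ?exprn_ge0//.
  rewrite -lee_fin -integral_EFin_moment//; apply: integral_ge0 => w _.
  by rewrite lee_fin -mul2n exprM exprn_ge0// sqr_ge0.
by apply: nearW => n /=; rewrite sumEFin lee_fin; exact: XB.
Qed.

Lemma integral_gauss_cvg (R : realType) d (T : measurableType d)
    (P : probability T R) (X : {RV P >-> R}) (p q : R) :
  has_moments X ->
  (forall a : R, 0 <= a -> (\int[P]_w (expR (a * X w ^+ 2))%:E < +oo)%E) ->
  (\int[P]_w (series (exp_coeff (- (p + q * X w) ^+ 2)) n)%:E)%E @[n --> \oo] -->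
  (\int[P]_w (gauss_fun (p + q * X w))%:E)%E.
Proof.
move=> hX Xexp.
have mX : measurable_fun setT X by [].
have mq : measurable_fun setT (fun w => p + q * X w).
  by apply: measurable_funD => //; apply: measurable_funM.
(* Partial sums of exp(-y^2) are at most exp(y^2), and
   (p + q x)^2 <= 2 p^2 + 2 q^2 x^2. *)
pose g w := (expR (2 * p ^+ 2) * expR (2 * q ^+ 2 * X w ^+ 2)).
have ig : P.-integrable setT (EFin \o g).
  have -> : EFin \o g = (fun w => (expR (2 * p ^+ 2))%:E *
      (expR (2 * q ^+ 2 * X w ^+ 2))%:E)%E.
    by apply/funext => w; rewrite /g/= EFinM.
  apply: integrableZl => //; apply/integrableP; split.
    apply/measurable_EFinP; apply: measurableT_comp => //.
    by apply: measurable_funM => //; exact: measurable_funX.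
  under eq_integral => w _ do rewrite gee0_abs ?lee_fin ?expR_ge0//.
  by apply: Xexp; rewrite mulr_ge0 ?sqr_ge0.
have [] := @dominated_convergence _ _ _ P setT measurableT
  (fun n w => (series (exp_coeff (- (p + q * X w) ^+ 2)) n)%:E)
  (fun w => (gauss_fun (p + q * X w))%:E) (EFin \o g).
- move=> n; apply/measurable_EFinP; apply: measurable_sum => i.
  rewrite /exp_coeff; apply: measurable_funM => //; apply: measurable_funX.
  by apply: measurableT_comp => //; exact: measurable_funX.
- apply/measurable_EFinP; apply: (measurableT_comp (@measurable_gauss_fun R)).
  exact: mq.
- apply: aeW => w _; apply: cvg_EFin; first exact: nearW.
  exact: is_cvg_series_exp_coeff.
- exact: ig.
- apply: aeW => w n _; rewrite /= lee_fin.
  apply: (le_trans (series_exp_coeff_le _ _)).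
  rewrite /g -expRD ler_expR normrN ger0_norm ?sqr_ge0//.
  have := sqr_ge0 (p - q * X w); nra.
by [].
Qed.

(** The expectation of exp(-(p + q X)^2) is the limit of the expectations of its
    Taylor polynomials, which are linear combinations of moments. The Gaussian
    exponential moments provide the domination. *)
Lemma integral_gauss_eq (R : realType) d1 (T1 : measurableType d1)
    (P1 : probability T1 R) (X : {RV P1 >-> R}) d2 (T2 : measurableType d2)
    (P2 : probability T2 R) (Y : {RV P2 >-> R}) (p q : R) :
  has_moments X -> has_moments Y -> (forall m, moment Y m = moment X m) ->
  (forall a : R, 0 <= a -> (\int[P1]_w (expR (a * X w ^+ 2))%:E < +oo)%E) ->
  (forall a : R, 0 <= a -> (\int[P2]_w (expR (a * Y w ^+ 2))%:E < +oo)%E) ->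
  (\int[P1]_w (gauss_fun (p + q * X w))%:E =
   \int[P2]_w (gauss_fun (p + q * Y w))%:E)%E.
Proof.
move=> hX hY XY eX eY.
rewrite -(cvg_lim _ (integral_gauss_cvg hX eX))//.
rewrite -(cvg_lim _ (integral_gauss_cvg hY eY))//.
congr (limn _); apply/funext => n.
(* The Taylor polynomial of exp(-(p + q X)^2), as a polynomial in X. *)
pose r : {poly R} := \sum_(0 <= k < n)
  (k`!%:R)^-1 *: (- (p%:P + q *: 'X) ^+ 2) ^+ k.
have rE x : series (exp_coeff (- (p + q * x) ^+ 2)) n = r.[x].
  rewrite /r horner_sum; apply: eq_bigr => k _.
  by rewrite /exp_coeff !hornerE/= mulrC; congr (_ * (_ ^+ k)); rewrite !hornerE.
under eq_integral do rewrite rE; under [RHS]eq_integral do rewrite rE.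
rewrite !integral_horner//; congr EFin; apply: eq_bigr => i _.
by rewrite XY.
Qed.

Lemma integral_gauss_ray (R : realType) (r : R) :
  (\int[lebesgue_measure]_(b in `]-oo, r]) (gauss_fun b)%:E =
   \int[lebesgue_measure]_(b in `]-oo, 0%R]) (gauss_fun (b + r))%:E)%E.
Proof.
have dF (x : R) : derivable (fun b : R => b + r) x 1 by [].
have F1 : derive1 (fun b : R => b + r) = cst 1.
  by apply/funext => x; rewrite derive1E deriveD// derive_id derive_cst addr0.
rewrite -[r in LHS]add0r.
rewrite (@increasing_ge0_integration_by_substitutionNy _ (fun b => b + r))//.
- by apply: eq_integral => x _; rewrite F1/= mulr1.
- by move=> x y _ _; rewrite ltrD2r.
- by rewrite F1 => x _; exact: cvg_cst.
- by rewrite F1; exact: is_cvg_cst.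
- by rewrite F1; exact: cvg_cst.
- split => //; apply: cvg_at_left_filter; apply: cvgD; [exact: cvg_id|exact: cvg_cst].
- by apply/cvgrNyPle => M; near=> x; rewrite -lerBrDr; near: x; apply: nbhs_ninfty_le; exact: num_real.
- by apply: continuous_subspaceT; exact: continuous_gauss_fun.
- by move=> x _; exact: gauss_fun_ge0.
Unshelve. all: by end_near. Qed.

Lemma integral_gauss_ray_le (R : realType) (r : R) :
  (\int[lebesgue_measure]_(b in `]-oo, r]) (gauss_fun b)%:E <=
   (Num.sqrt (@pi R))%:E)%E.
Proof.
rewrite -integralT_gauss; apply: ge0_subset_integral => //.
- exact: measurable_int (@integrableT_gauss R).
- by move=> x _; rewrite lee_fin gauss_fun_ge0.
Qed.

(** Moving the endpoint r into the integrand makes the Gaussian integral over a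
    ray an integral over a fixed ray, to which Tonelli's theorem applies when r
    is random. *)
Lemma integral_gauss_rayE (R : realType) (r : R) :
  (\int[lebesgue_measure]_(b in `]-oo, r]) (gauss_fun b)%:E =
   \int[lebesgue_measure]_b (\1_`]-oo, 0%R] b * gauss_fun (b + r))%:E)%E.
Proof.
rewrite integral_gauss_ray integral_mkcond; apply: eq_integral => b _.
by rewrite patchE indicE; case: ifP => _; rewrite ?mul1r ?mul0r.
Qed.

(** The endpoint n^2 (x - z) + n tends to +oo for z < x and to -oo for z > x. The
    drift n decides the case z = x, so that the limit is the indicator of the
    closed ray. *)
Lemma cvg_integral_gauss_ray (R : realType) (x z : R) :
  (\int[lebesgue_measure]_(b in `]-oo, (n%:R ^+ 2 * (x - z) + n%:R)%R])
     (gauss_fun b)%:E)%E @[n --> \oo] -->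
  (Num.sqrt (@pi R) * \1_`]-oo, x] z)%:E.
Proof.
pose r n : R := n%:R ^+ 2 * (x - z) + n%:R.
have -> : ((Num.sqrt (@pi R) * \1_`]-oo, x] z)%:E =
    \int[lebesgue_measure]_b (gauss_fun b * \1_`]-oo, x] z)%:E)%E.
  under eq_integral do rewrite EFinM.
  by rewrite integralZr// ?integralT_gauss//; exact: integrableT_gauss.
have mg := measurable_int _ (@integrableT_gauss R).
under eq_fun => n do rewrite integral_mkcond.
apply: (@dominated_cvg _ _ _ lebesgue_measure setT measurableT _ _
  (EFin \o @gauss_fun R)) => //.
- move=> n; apply/(measurable_restrictT _ _).1 => //.
  exact: measurable_funTS mg.
- move=> b _; rewrite indicE; have [zx|xz] := leP z x.
    rewrite (mem_set (A := `]-oo, x]%classic)); last by rewrite /= in_itv.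
    rewrite mulr1; apply: cvg_near_cst; near=> n; rewrite patchE mem_set//=.
    rewrite in_itv/=; apply: (@le_trans _ _ n%:R); last first.
      by rewrite lerDr mulr_ge0 ?sqr_ge0 ?subr_ge0.
    by near: n; exact: nbhs_infty_ger.
  rewrite (memNset (A := `]-oo, x]%classic)); last first.
    by rewrite /= in_itv/=; apply/negP; rewrite -ltNge.
  (* For z > x the quadratic term eventually outweighs both n and |b|. *)
  rewrite mulr0; apply: cvg_near_cst; near=> n; rewrite patchE memNset//=.
  rewrite in_itv/=; apply/negP; rewrite -ltNge.
  have zx0 : 0 < z - x by rewrite subr_gt0.
  have n1 : (2 + `|b|) / (z - x) <= n%:R by near: n; exact: nbhs_infty_ger.
  have n2 : 1 <= n%:R :> R by near: n; exact: nbhs_infty_ger.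
  move: n1; rewrite ler_pdivrMr// => n1.
  have := ler_norm (- b); rewrite normrN => n3.
  have : 0 <= (n%:R - 1) * (n%:R * (z - x) - 1).
    by rewrite mulr_ge0 ?subr_ge0//; have := normr_ge0 b; lra.
  by rewrite expr2; nra.
- exact: integrableT_gauss.
- move=> n b _; rewrite patchE; case: ifPn => _ /=.
    by rewrite lee_fin ger0_norm ?gauss_fun_ge0.
  by rewrite normr0 lee_fin gauss_fun_ge0.
Unshelve. all: end_near. Qed.

Lemma measurable_gauss_kernel (R : realType) : measurable_fun setT
  (fun z : R * R => (\1_`]-oo, 0%R] z.2 * gauss_fun (z.2 + z.1))%:E).
Proof.
apply/measurable_EFinP; apply: measurable_funM; first exact: measurableT_comp.
apply: (measurableT_comp (@measurable_gauss_fun R)).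
exact: measurable_funD.
Qed.

Lemma measurable_gauss_ray (R : realType) : measurable_fun setT
  (fun r : R => (\int[lebesgue_measure]_(b in `]-oo, r]) (gauss_fun b)%:E)%E).
Proof.
under eq_fun do rewrite integral_gauss_rayE.
apply: (@measurable_fun_fubini_tonelli_F _ _ R
  (measurableTypeR R) R (@lebesgue_measure R) _
  (@measurable_gauss_kernel R)) => z.
by rewrite lee_fin mulr_ge0// gauss_fun_ge0.
Qed.

(** By Tonelli's theorem, the left-hand side is an integral over b <= 0 of
    Gaussian functionals of X with p replaced by b + p. *)
Lemma integral_gauss_ray_eq (R : realType) d1 (T1 : measurableType d1)
    (P1 : probability T1 R) (X : {RV P1 >-> R}) d2 (T2 : measurableType d2)
    (P2 : probability T2 R) (Y : {RV P2 >-> R}) (p q : R) :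
  (forall p q : R, \int[P1]_w (gauss_fun (p + q * X w))%:E =
   \int[P2]_w (gauss_fun (p + q * Y w))%:E)%E ->
  (\int[P1]_w \int[lebesgue_measure]_(b in `]-oo, (p + q * X w)%R])
      (gauss_fun b)%:E =
   \int[P2]_w \int[lebesgue_measure]_(b in `]-oo, (p + q * Y w)%R])
      (gauss_fun b)%:E)%E.
Proof.
move=> XY.
pose k (c z : R) := (\1_`]-oo, 0%R] z * gauss_fun (z + (p + q * c)))%:E.
under eq_integral do rewrite integral_gauss_rayE.
under [RHS]eq_integral do rewrite integral_gauss_rayE.
have mk d (T : measurableType d) (P : probability T R) (W : {RV P >-> R}) :
    measurable_fun setT (fun z : T * R => k (W z.1) z.2).
  apply: (measurableT_comp (@measurable_gauss_kernel R) (g := fun z : T * R =>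
    (p + q * W z.1, z.2))).
  apply/measurable_fun_pairP; split; last exact: measurable_snd.
  apply: measurable_funD => //.
  by apply: measurable_funM => //; apply: measurableT_comp.
have k0 c z : (0 <= k c z)%E.
  by rewrite lee_fin mulr_ge0// ?gauss_fun_ge0.
have /= -> := @fubini_tonelli _ _ _ (measurableTypeR R) R P1 lebesgue_measure
  _ (mk _ _ P1 X) (fun z => k0 _ _).
have /= -> := @fubini_tonelli _ _ _ (measurableTypeR R) R P2 lebesgue_measure
  _ (mk _ _ P2 Y) (fun z => k0 _ _).
apply: eq_integral => b _ /=; rewrite /k.
under eq_integral do rewrite EFinM addrA.
under [RHS]eq_integral do rewrite EFinM addrA.
have mg d (T : measurableType d) (P : probability T R) (W : {RV P >-> R}) :
    measurable_fun setT (fun w : T => (gauss_fun (b + p + q * W w))%:E).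
  apply/measurable_EFinP; apply: (measurableT_comp (@measurable_gauss_fun R)).
  by apply: measurable_funD => //; apply: measurable_funM.
rewrite !ge0_integralZl ?lee_fin//; try exact: mg.
- by rewrite XY.
- by move=> w _; rewrite lee_fin gauss_fun_ge0.
- by move=> w _; rewrite lee_fin gauss_fun_ge0.
Qed.

Lemma cvg_integral_gauss_cdf (R : realType) d (T : measurableType d)
    (P : probability T R) (X : {RV P >-> R}) (x : R) :
  (\int[P]_w \int[lebesgue_measure]_(b in
      `]-oo, (n%:R ^+ 2 * x + n%:R + (- n%:R ^+ 2) * X w)%R])
     (gauss_fun b)%:E)%E @[n --> \oo] -->
  ((Num.sqrt (@pi R))%:E * P (X @^-1` `]-oo, x]))%E.
Proof.
have mX : measurable (X @^-1` `]-oo, x]).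
  by rewrite -[X in measurable X]setTI; exact: measurable_funP.
have -> : ((Num.sqrt (@pi R))%:E * P (X @^-1` `]-oo, x]) =
    \int[P]_w (Num.sqrt (@pi R) * \1_`]-oo, x] (X w))%:E)%E.
  under eq_integral do rewrite EFinM.
  rewrite ge0_integralZl ?lee_fin ?sqrtr_ge0//.
  - rewrite -(setIT (X @^-1` _)) -(integral_indic P measurableT mX).
    by congr (_ * _)%E; apply: eq_integral.
  - by apply/measurable_EFinP; apply: measurableT_comp => //.
apply: (@dominated_cvg _ _ _ P setT measurableT _ _ (cst (Num.sqrt (@pi R))%:E)) => //.
- move=> n; apply: (measurableT_comp (@measurable_gauss_ray R)).
  by apply: measurable_funD => //; apply: measurable_funM.
- move=> w _; have := @cvg_integral_gauss_ray R x (X w).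
  apply: cvg_trans; apply: near_eq_cvg; apply: nearW => n.
  have -> // : n%:R ^+ 2 * (x - X w) + n%:R =
    n%:R ^+ 2 * x + n%:R + - n%:R ^+ 2 * X w :> R by ring.
- exact: finite_measure_integrable_cst.
- move=> n w _; rewrite gee0_abs ?integral_gauss_ray_le//.
  by apply: integral_ge0 => b _; rewrite lee_fin gauss_fun_ge0.
Qed.

(** The expectations of Gaussian integrals over rays with endpoint an affine
    function of X depend only on the moments, and they approximate the
    distribution function of X. *)
Lemma moment_determinacy (R : realType) d1 (T1 : measurableType d1)
    (P1 : probability T1 R) (X : {RV P1 >-> R}) d2 (T2 : measurableType d2)
    (P2 : probability T2 R) (Y : {RV P2 >-> R}) :
  has_moments X -> has_moments Y -> (forall m, moment Y m = moment X m) ->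
  (forall a : R, 0 <= a -> exists B, forall n,
     \sum_(0 <= j < n) a ^+ j / j`!%:R * moment X j.*2 <= B) ->
  eq_law (@measurable _ R) P2 Y P1 X.
Proof.
move=> hX hY YX XB.
have gE (p q : R) : (\int[P1]_w (gauss_fun (p + q * X w))%:E =
   \int[P2]_w (gauss_fun (p + q * Y w))%:E)%E.
  apply: integral_gauss_eq => // a a0; have [B aB] := XB a a0.
    exact: expR_sqr_lty aB.
  apply: (@expR_sqr_lty _ _ _ _ _ _ B) => // n.
  by under eq_bigr do rewrite YX.
have rayE (x : R) : P2 (Y @^-1` `]-oo, x]) = P1 (X @^-1` `]-oo, x]).
  have c1 := @cvg_integral_gauss_cdf _ _ _ P1 X x.
  have c2 := @cvg_integral_gauss_cdf _ _ _ P2 Y x.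
  have : ((Num.sqrt (@pi R))%:E * P2 (Y @^-1` `]-oo, x]) =
          (Num.sqrt (@pi R))%:E * P1 (X @^-1` `]-oo, x]))%E.
    rewrite -(cvg_lim _ c1)// -(cvg_lim _ c2)//.
    by congr (limn _); apply/funext => n; rewrite (integral_gauss_ray_eq _ _ gE).
  have pi0 : Num.sqrt (@pi R) != 0 by rewrite gt_eqF// sqrtr_gt0 pi_gt0.
  by move/(congr1 (fun y => (Num.sqrt (@pi R))^-1%:E * y)%E); rewrite !muleA -!EFinM mulVf// !mul1e.
have mray d (T : measurableType d) (P : probability T R) (W : {RV P >-> R}) x :
    measurable (W @^-1` `]-oo, x]).
  by rewrite -[X in measurable X]setTI; exact: measurable_funP.
have PE x : P2 (Y @^-1` `]x, +oo[) = P1 (X @^-1` `]x, +oo[).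
  rewrite -setCitvl !preimage_setC !probability_setC ?rayE//; exact: mray.
move=> A mA.
change (distribution P2 Y A = distribution P1 X A).
have mG : @measurable _ R = <<s @RGenOInfty.G R >> by exact: RGenOInfty.measurableE.
apply: (@measure_unique _ R R (@RGenOInfty.G R)
  (fun n => `]- n%:R, +oo[%classic) _ _ _ _ (distribution P2 Y) (distribution P1 X)) => //.
- move=> _ _ [x ->] [y ->]; exists (Num.max x y).
  apply/seteqP; split => z /=; rewrite !in_itv/= !andbT gt_max.
    by move=> [-> ->].
  by move=> /andP[].
- by move=> n; exists (- n%:R).
- apply/seteqP; split => // z _; exists (Num.trunc `|z|).+1 => //=.
  rewrite in_itv/= andbT ltrNl; apply: le_lt_trans (truncnS_gt _).
  by rewrite -normrN ler_norm.
- by move=> _ [x ->]; exact: PE.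
- by move=> n; rewrite (le_lt_trans (probability_le1 _ _))// ltry.
Qed.

(** * Measurable evaluation on path space *)

Definition cylinder_gen (R : realType) : set (set (R -> R)) :=
  [set C | exists2 s : R, s \in `[0, 1] &
    exists2 B : set R, measurable B & C = [set f : R -> R | B (f s)]].

Definition path_space (R : realType) := g_sigma_algebraType (@cylinder_gen R).

Lemma measurable_eval (R : realType) (s : R) : s \in `[0, 1] ->
  measurable_fun setT (fun f : path_space R => f s).
Proof.
move=> s01 _ B mB; rewrite setTI; apply: sub_sigma_algebra.
by exists s => //; exists B.
Qed.

Lemma measurable_path_of (R : realType) d (T : measurableType d)
    (P : probability T R) (Z : R -> {RV P >-> R}) :
  measurable_fun setT (path_of Z : T -> path_space R).
Proof.
apply: (@measurability _ _ _ (path_space R) setT (path_of Z) (@cylinder_gen R)) => //.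
move=> _ [_ [s s01 [B mB ->]] <-] /=; rewrite setTI.
rewrite [X in measurable X](_ : _ = Z s @^-1` B)//.
by rewrite -[X in measurable X]setTI; exact: measurable_funP.
Qed.

(** The step function that takes the value of f at the left grid point. A finite
    sum over deterministic grid points in [0, 1] is jointly measurable in t and f;
    the index k = n.+1 serves t = 1. *)
Definition grid_eval (R : realType) (n : nat) (t : R) (f : R -> R) : R :=
  \sum_(k < n.+2) \1_(`[k%:R / n.+1%:R, k.+1%:R / n.+1%:R[%classic) t
    * f (k%:R / n.+1%:R).

(** Evaluation at a variable time is not measurable on all paths. The upper limit
    of the step functions is, and it is the evaluation on continuous paths. *)
Definition path_eval (R : realType) (t : R) (f : R -> R) : R :=
  fine (limn_esup (fun n => (grid_eval n t f)%:E)).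

Lemma grid_evalE (R : realType) (n : nat) (t : R) (f : R -> R) :
  t \in `[0, 1] ->
  grid_eval n t f = f ((Num.trunc (t * n.+1%:R))%:R / n.+1%:R).
Proof.
rewrite in_itv/= => /andP[t0 t1].
have tn0 : 0 <= t * n.+1%:R by rewrite mulr_ge0.
set k := Num.trunc _.
have kn : (k < n.+2)%N.
  rewrite ltnS truncn_le_nat (le_lt_trans (y := n.+1%:R))//.
    by rewrite ler_piMl.
  by rewrite ltr_nat.
rewrite /grid_eval (bigD1 (Ordinal kn))//= big1 ?addr0.
  rewrite indicE mem_set ?mul1r//= in_itv/=.
  rewrite ler_pdivrMr ?ltr0n// ltr_pdivlMr ?ltr0n//.
  by rewrite truncn_le tn0 truncnS_gt.
move=> i ik; rewrite indicE memNset ?mul0r//= in_itv/=.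
rewrite ler_pdivrMr ?ltr0n// ltr_pdivlMr ?ltr0n// => /andP[it ti].
move/negP: ik; apply; apply/eqP/val_inj => /=.
apply/eqP; rewrite eqn_leq /k truncn_ge_nat// it/=.
by rewrite truncn_le_nat.
Qed.

Lemma cvg_grid_eval (R : realType) (t : R) (f : R -> R) :
  t \in `[0, 1] -> {within `[0, 1], continuous f} ->
  grid_eval n t f @[n --> \oo] --> f t.
Proof.
move=> t01 cf; under eq_fun do rewrite grid_evalE//.
have /subspace_continuousP cf' := cf.
have /andP[t0 t1] : 0 <= t <= 1 by move: t01; rewrite in_itv.
pose g n : R := (Num.trunc (t * n.+1%:R))%:R / n.+1%:R.
have tn0 n : 0 <= t * n.+1%:R by rewrite mulr_ge0.
have gle n : g n <= t by rewrite ler_pdivrMr ?ltr0n// truncn_le.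
have gge n : t - n.+1%:R^-1 <= g n.
  rewrite ler_pdivlMr ?ltr0n// mulrBl mulVf// lerBlDr natr1.
  by rewrite ltW// truncnS_gt.
have gt : g @ \oo --> t.
  apply: (@squeeze_cvgr _ _ _ _ (fun n => t - n.+1%:R^-1) (cst t)).
  - by apply: nearW => n; rewrite gge gle.
  - rewrite -[X in _ --> X]subr0; apply: cvgB; first exact: cvg_cst.
    exact: cvg_harmonic.
  - exact: cvg_cst.
apply: (cvg_comp g f _ (cf' t t01)) => A /gt; rewrite /= !near_simpl.
apply: filterS => n; apply.
by rewrite /= in_itv/= divr_ge0//= (le_trans (gle n)).
Qed.

Lemma path_evalE (R : realType) (t : R) (f : R -> R) :
  t \in `[0, 1] -> {within `[0, 1], continuous f} -> path_eval t f = f t.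
Proof.
move=> t01 cf; rewrite /path_eval.
have c : (grid_eval n t f)%:E @[n --> \oo] --> (f t)%:E.
  by apply: cvg_EFin; [exact: nearW|exact: cvg_grid_eval].
by rewrite is_cvg_limn_esupE ?(cvg_lim _ c)//; apply/cvg_ex; exists (f t)%:E.
Qed.

Lemma measurable_path_eval (R : realType) :
  measurable_fun setT (fun z : measurableTypeR R * path_space R => path_eval z.1 z.2).
Proof.
rewrite /path_eval; apply: (measurableT_comp (@fine_measurable R setT measurableT)).
apply: measurable_fun_limn_esup => n; apply/measurable_EFinP.
apply: measurable_sum => k; apply: measurable_funM.
  by apply: measurableT_comp => //; exact: measurable_indic.
apply: (measurableT_comp (measurable_eval _)) => //.
rewrite in_itv/= divr_ge0//= ler_pdivrMr// mul1r ler_nat.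
by rewrite -ltnS.
Qed.

HB.instance Definition _ (R : realType) d (T : measurableType d)
    (P : probability T R) (Z : R -> {RV P >-> R}) :=
  isMeasurableFun.Build _ _ T (path_space R) (path_of Z : T -> path_space R)
    (measurable_path_of Z).

Definition path_law (R : realType) d (T : measurableType d)
    (P : probability T R) (Z : R -> {RV P >-> R}) : probability (path_space R) R :=
  distribution P (path_of Z : T -> path_space R).

Lemma integral_path_eval (R : realType) d (T : measurableType d)
    (P : probability T R) (Z : R -> {RV P >-> R}) (t : R) (F : R -> R) :
  continuous_process Z -> t \in `[0, 1] -> measurable_fun setT F ->
  P.-integrable setT (fun w => (F (Z t w))%:E) ->
  (path_law Z).-integrable setT (fun f => (F (path_eval t f))%:E) /\
  (\int[path_law Z]_f (F (path_eval t f))%:E = \int[P]_w (F (Z t w))%:E)%E.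
Proof.
move=> cZ t01 mF iF.
have mev : measurable_fun setT (fun f : path_space R => path_eval t f).
  have mp : measurable_fun setT (fun f : path_space R => (t : measurableTypeR R, f)).
    by apply/measurable_fun_pairP; split; [exact: measurable_cst|exact: measurable_id].
  by have h := measurableT_comp (@measurable_path_eval R) mp; exact: h.
pose G (f : path_space R) := (F (path_eval t f))%:E.
have mG : measurable_fun setT G.
  by apply/measurable_EFinP; exact: measurableT_comp.
have evE : G \o path_of Z = (fun w => (F (Z t w))%:E).
  by apply/funext => w; rewrite /G/= path_evalE.
have iG : P.-integrable setT (G \o path_of Z) by rewrite evE.
split; last first.
  have := @integral_distribution _ _ _ _ _ P
    (path_of Z : {RV P >-> path_space R}) G mG iG.
  by rewrite evE.
apply/integrableP; split => //.
have mG' : measurable_fun setT (fun f => `|G f|%E) by exact: measurableT_comp.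
have /= -> := @ge0_integral_distribution _ _ _ _ _ P
    (path_of Z : {RV P >-> path_space R}) (fun f => `|G f|%E) mG' (fun f => abse_ge0 _).
by have /integrableP[] := iG.
Qed.

(** * The law of the right-hand side of the equation *)

(** Product events form a pi-system that generates the product sigma-algebra. The
    event D lets independence of several variables be assembled one variable at
    a time. *)
Lemma joint_law_unique (R : realType) d (T : measurableType d)
    (P : probability T R) d1 (E1 : measurableType d1) d2 (E2 : measurableType d2)
    (m1 : probability E1 R) (m2 : probability E2 R) (D : set T)
    (X : T -> E1) (Y : T -> E2) :
  measurable D -> measurable_fun setT X -> measurable_fun setT Y ->
  (forall A B, measurable A -> measurable B ->
    P (D `&` (X @^-1` A `&` Y @^-1` B)) = (P D * (m1 A * m2 B))%E) ->
  forall S, measurable S ->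
    P (D `&` (fun w => (X w, Y w)) @^-1` S) = (P D * (m1 \x m2) S)%E.
Proof.
move=> mD mX mY DXY S mS.
have mXY : measurable_fun setT (fun w => (X w, Y w)).
  by apply/measurable_fun_pairP.
pose W := fun w => (X w, Y w).
pose nu := pushforward (mrestr P mD) W.
have PD0 : 0 <= fine (P D) by rewrite fine_ge0.
have PDE : P D = (fine (P D))%:E by rewrite fineK// fin_num_measure.
pose c : {nonneg R} := NngNum PD0.
pose C : set (set (E1 * E2)) :=
  [set C | exists2 A, measurable A & exists2 B, measurable B & C = A `*` B].
have e := @measure_unique _ R (E1 * E2)%type C (fun=> setT) _ _ _ _
  nu (mscale c (m1 \x m2)%E) _ _ S mS.
have nuE A : nu A = P (D `&` W @^-1` A) by exact: (congr1 P (setIC _ _)).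
rewrite -[LHS]nuE.
rewrite PDE; apply: (e _ _ _ _ mXY) => //.
- rewrite measurable_prod_measurableType; congr (<<s _ >>).
  apply/seteqP; split => [A [A1 mA1 [A2 mA2 <-]]|A [A1 mA1 [A2 mA2 ->]]].
    by exists A1 => //; exists A2.
  by exists A1 => //; exists A2.
- move=> _ _ [A mA [B mB ->]] [A' mA' [B' mB' ->]]; rewrite -setXI.
  exists (A `&` A'); first exact: measurableI.
  by exists (B `&` B') => //; exact: measurableI.
- by move=> _; exists setT => //; exists setT => //; rewrite setXTT.
- by apply/seteqP; split => // z _; exists 0%N.
- move=> _ [A mA [B mB ->]].
  apply: (etrans (nuE _)); apply: (etrans (DXY _ _ mA mB)).
  rewrite PDE /mscale/=; congr (_ * _)%E; exact/esym/product_measure1E.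
- move=> _; apply: (eq_rect_r (fun x => (x < +oo)%E) _ (nuE setT)).
  apply: le_lt_trans (probability_le1 _ _) (ltry 1).
  by rewrite preimage_setT setIT.
Qed.

Lemma bigcap_prod4 (R : realType) d (T : measurableType d)
    (P : probability T R) (I : choiceType) (F : I -> set (set T)) (a b c e : I)
    (A B C E : set T) :
  uniq [:: a; b; c; e] -> mutually_independent P F ->
  F a A -> F b B -> F c C -> F e E ->
  P (A `&` B `&` (C `&` E)) = (P A * P B * (P C * P E))%E.
Proof.
move=> u ind FA FB FC FE.
pose G i := if i == a then A else if i == b then B else if i == c then C else E.
have Ga : G a = A by rewrite /G eqxx.
move: u; rewrite /= !inE !negb_or !andbT => /andP[/and3P[ab ac ae] /andP[/andP[bc be] ce]].
have Gb : G b = B by rewrite /G eq_sym (negbTE ab) eqxx.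
have Gc : G c = C by rewrite /G !(eq_sym c) (negbTE ac) (negbTE bc) eqxx.
have Ge : G e = E by rewrite /G !(eq_sym e) (negbTE ae) (negbTE be) (negbTE ce).
pose J : {fset I} := (a |` (b |` (c |` [fset e])))%fset.
have inJ i : (i \in J) = [|| i == a, i == b, i == c | i == e].
  by rewrite !in_fset1U in_fset1.
have FG i : i \in J -> F i (G i).
  by rewrite inJ => /or4P[] /eqP ->; rewrite ?Ga ?Gb ?Gc ?Ge.
have := ind J G FG.
rewrite (_ : \bigcap_(i in _) G i = A `&` B `&` (C `&` E)); last first.
  apply/seteqP; split => w /=.
    move=> h; split; split.
    - by rewrite -Ga; apply: h; rewrite /= inJ eqxx.
    - by rewrite -Gb; apply: h; rewrite /= inJ eqxx orbT.
    - by rewrite -Gc; apply: h; rewrite /= inJ eqxx !orbT.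
    - by rewrite -Ge; apply: h; rewrite /= inJ eqxx !orbT.
  move=> [[hA hB] [hC hE]] i /=; rewrite inJ.
  by move=> /or4P[] /eqP ->; rewrite ?Ga ?Gb ?Gc ?Ge.
move=> ->; rewrite /J !big_fsetU1 ?big_seq_fset1/= ?Ga ?Gb ?Gc ?Ge ?muleA//.
- by rewrite in_fset1.
- by rewrite in_fset1U in_fset1 negb_or bc.
- by rewrite !in_fset1U in_fset1 !negb_or ab ac.
Qed.

Notation rde_space R := (measurableTypeR R * (measurableTypeR R *
  (path_space R * path_space R)))%type.

Definition rde_law (R : realType) d (T : measurableType d)
    (P : probability T R) (Z : R -> {RV P >-> R}) :
    probability (rde_space R) R :=
  (uniform_prob (@ltr01 R) \x (uniform_prob (@ltr01 R) \x
    (path_law Z \x path_law Z)))%E.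

(** Only two of the four copies occur for a given s and U, so the law of U, V and
    two distinct copies is all that is needed. *)
Lemma rde_joint_law (R : realType) d (T : measurableType d)
    (P : probability T R) (Z : R -> {RV P >-> R}) d' (T' : measurableType d')
    (P' : probability T' R) (U V : {RV P' >-> R})
    (Zc : 'I_4 -> R -> {RV P' >-> R}) (i j : 'I_4) :
  uniform01 U -> uniform01 V ->
  mutually_independent P' (rde_sigmas U V Zc) ->
  (forall k, eq_law (@cylinder R) P' (path_of (Zc k)) P (path_of Z)) ->
  i != j ->
  forall S : set (rde_space R), measurable S ->
  P' ((fun w => (U w, (V w, (path_of (Zc i) w, path_of (Zc j) w)))) @^-1` S)
    = rde_law Z S.
Proof.
move=> uU uV ind lawZ ij S mS.
have mU : measurable_fun setT (U : T' -> measurableTypeR R).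
  by have h : measurable_fun setT U by []; exact: h.
have mV : measurable_fun setT (V : T' -> measurableTypeR R).
  by have h : measurable_fun setT V by []; exact: h.
have mZ k := measurable_path_of (Zc k).
have mpre (W : T' -> measurableTypeR R) (A : set (measurableTypeR R)) :
    measurable_fun setT W -> measurable A -> measurable (W @^-1` A).
  by move=> mW mA; rewrite -[X in measurable X]setTI; exact: mW.
have indE (A B : set (measurableTypeR R)) (C D : set (path_space R)) : measurable A -> measurable B -> measurable C -> measurable D ->
    P' (U @^-1` A `&` V @^-1` B `&`
        (path_of (Zc i) @^-1` C `&` path_of (Zc j) @^-1` D)) =
    (uniform_prob (@ltr01 R) A * uniform_prob (@ltr01 R) B *
     (path_law Z C * path_law Z D))%E.
  move=> mA mB mC mD.
  rewrite (@bigcap_prod4 _ _ _ _ _ _ (inl true) (inl false) (inr i) (inr j) _ _ _ _ _ ind).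
  - by congr (_ * _ * (_ * _))%E; [exact: uU|exact: uV|exact: lawZ|exact: lawZ].
  - by rewrite /= !inE/= andbT.
  - by exists A => //; rewrite setTI.
  - by exists B => //; rewrite setTI.
  - by exists C => //; rewrite setTI.
  - by exists D => //; rewrite setTI.
have indU (A : set (measurableTypeR R)) : measurable A -> P' (U @^-1` A) = uniform_prob (@ltr01 R) A.
  exact: uU.
have indUV (A B : set (measurableTypeR R)) : measurable A -> measurable B ->
    P' (U @^-1` A `&` V @^-1` B) = (uniform_prob (@ltr01 R) A * uniform_prob (@ltr01 R) B)%E.
  move=> mA mB; have := indE A B setT setT mA mB measurableT measurableT.
  by rewrite !preimage_setT !setIT !probability_setT !mule1.
(* The product structure is built from the inside out: first the two paths,
   given the events of U and V, then V together with the paths, then U. *)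
have e3 (A B : set (measurableTypeR R)) (F : set (path_space R * path_space R)%type) : measurable A -> measurable B -> measurable F ->
   P' (U @^-1` A `&` V @^-1` B `&`
     (fun w => (path_of (Zc i) w, path_of (Zc j) w)) @^-1` F) =
   (P' (U @^-1` A `&` V @^-1` B) * (path_law Z \x path_law Z) F)%E.
  move=> mA mB mF; apply: joint_law_unique => //.
    by apply: measurableI; exact: mpre.
  by move=> C D mC mD; rewrite indE// indUV.
have e2 (A : set (measurableTypeR R))
    (F : set (measurableTypeR R * (path_space R * path_space R))%type) : measurable A -> measurable F ->
   P' (U @^-1` A `&`
     (fun w => (V w, (path_of (Zc i) w, path_of (Zc j) w))) @^-1` F) =
   (P' (U @^-1` A) * (uniform_prob (@ltr01 R) \x (path_law Z \x path_law Z)) F)%E.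
  move=> mA mF; apply: joint_law_unique => //.
  - exact: mpre.
  - by apply/measurable_fun_pairP.
  - by move=> B G mB mG; rewrite setIA e3// indUV// indU// muleA.
have -> : rde_law Z S = (P' setT * rde_law Z S)%E by rewrite probability_setT mul1e.
rewrite -[X in P' X = _]setTI; apply: joint_law_unique => //.
  by apply/measurable_fun_pairP; split => //; exact/measurable_fun_pairP.
move=> A F mA mF.
by rewrite setTI e2// indU// probability_setT mul1e.
Qed.

(** Length of the part of [0, 1], cut at u, that contains s. *)
Definition rde_scale (R : realType) (s u : R) : R := if s < u then u else 1 - u.

(** Relative position of s in its part. *)
Definition rde_time (R : realType) (s u : R) : R :=
  if s < u then s / u else (s - u) / (1 - u).

Definition rde_comb (R : realType) (s u v x y : R) : R :=
  rde_scale s u `^ beta_exp R *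
  (v `^ beta_exp R * x + (1 - v) `^ beta_exp R * y).

Lemma rde_scale_ge0 (R : realType) (s u : R) : s \in `[0, 1] ->
  0 <= rde_scale s u.
Proof.
rewrite in_itv/= /rde_scale => /andP[s0 s1]; case: ltP => su.
  by rewrite (le_trans s0)// ltW.
by rewrite subr_ge0 (le_trans su).
Qed.

Lemma rde_scale_le1 (R : realType) (s u : R) : u \in `[0, 1] ->
  rde_scale s u <= 1.
Proof.
rewrite in_itv/= /rde_scale => /andP[u0 u1]; case: ifP => // _.
by rewrite gerBl.
Qed.

(** At u = 1 = s the quotient is 0 / 0 = 0, which also lies in [0, 1]. *)
Lemma rde_time01 (R : realType) (s u : R) : s \in `[0, 1] ->
  rde_time s u \in `[0, 1].
Proof.
rewrite !in_itv/= /rde_time => /andP[s0 s1]; case: ltP => su.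
  have u0 : 0 < u by rewrite (le_lt_trans s0).
  by rewrite divr_ge0 ?(ltW u0)//= ler_pdivrMr// mul1r ltW.
have [->|un] := eqVneq u 1; first by rewrite subrr invr0 mulr0 lexx ler01.
have u1 : u < 1 by rewrite lt_neqAle un (le_trans su).
rewrite divr_ge0 ?subr_ge0//= ?(ltW u1)// ler_pdivrMr ?subr_gt0// mul1r.
by rewrite lerD2r.
Qed.

Lemma measurable_rde_scale (R : realType) (s : R) :
  measurable_fun setT (rde_scale s).
Proof.
apply: measurable_fun_ifT => //; first exact: measurable_fun_ltr.
exact: measurable_funB.
Qed.

Lemma measurable_rde_time (R : realType) (s : R) : s \in `[0, 1] ->
  measurable_fun setT (rde_time s).
Proof.
move=> s01.
(* Both denominators are nonnegative where they occur, so the quotients are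
   products with a real power. *)
have -> : rde_time s =
    (fun u => if s < u then s * u `^ (-1) else (s - u) * (1 - u) `^ (-1)).
  apply/funext => u; rewrite /rde_time.
  have := rde_scale_ge0 u s01; rewrite /rde_scale.
  by case: ifP => _ r0; rewrite powR_inv1.
apply: measurable_fun_ifT => //; first exact: measurable_fun_ltr.
  by apply: measurable_funM => //; exact: measurable_powR.
apply: measurable_funM; first exact: measurable_funB.
by apply: (measurableT_comp (@measurable_powR R (-1))); exact: measurable_funB.
Qed.

Definition rde_map (R : realType) (s : R) (z : rde_space R) : R :=
  rde_comb s z.1 z.2.1 (path_eval (rde_time s z.1) z.2.2.1)
    (path_eval (rde_time s z.1) z.2.2.2).

Lemma measurable_rde_eval (R : realType) (s : R) : s \in `[0, 1] ->
  forall h : (path_space R * path_space R)%type -> path_space R,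
  measurable_fun setT h ->
  measurable_fun setT (fun z : rde_space R => path_eval (rde_time s z.1) (h z.2.2)).
Proof.
move=> s01 h mh; have mtime := measurable_rde_time s01.
apply: (measurableT_comp (@measurable_path_eval R)
  (g := fun z => (rde_time s z.1, h z.2.2))).
apply/measurable_fun_pairP; split.
  exact: (measurableT_comp mtime measurable_fst).
apply: (measurableT_comp mh).
exact: (measurableT_comp measurable_snd measurable_snd).
Qed.

Lemma measurable_rde_map (R : realType) (s : R) : s \in `[0, 1] ->
  measurable_fun setT (@rde_map R s).
Proof.
move=> s01.
have mscale := @measurable_rde_scale R s.
have mp := @measurable_powR R (beta_exp R).
have m1 : measurable_fun setT (fun z : rde_space R => z.2.1).
  exact: (measurableT_comp measurable_fst measurable_snd).
have ev := @measurable_rde_eval R s s01.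
apply: measurable_funM.
  apply: (measurableT_comp mp).
  exact: (measurableT_comp mscale measurable_fst).
apply: measurable_funD; apply: measurable_funM.
- exact: (measurableT_comp mp m1).
- exact: (ev _ measurable_fst).
- apply: (measurableT_comp mp); apply: measurable_funB => //; exact: m1.
- exact: (ev _ measurable_snd).
Qed.

Lemma rde_rhsE (R : realType) (s u v : R) (z : 'I_4 -> R -> R) :
  s \in `[0, 1] -> v \in `[0, 1] ->
  rde_rhs u v z s = rde_comb s u v (z (if s < u then 0 else 2) (rde_time s u))
    (z (if s < u then 1 else 3) (rde_time s u)).
Proof.
move=> s01; rewrite in_itv/= => /andP[v0 v1].
have := rde_scale_ge0 u s01; rewrite /rde_rhs /rde_comb /rde_scale /rde_time.
have v1' : 0 <= 1 - v by rewrite subr_ge0.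
by case: ifP => _ r0; rewrite !powRM// mulrDr !mulrA.
Qed.

Lemma measureI_null (R : realType) d (T : measurableType d)
    (mu : {measure set T -> \bar R}) (S D : set T) :
  measurable S -> measurable D -> mu (~` D) = 0%E -> mu (S `&` D) = mu S.
Proof.
move=> mS mD muD; have SD0 : mu (S `\` D) = 0%E.
  apply: (@subset_measure0 _ _ _ _ _ (~` D)) => //.
  - exact: measurableD.
  - exact: measurableC.
have /= -> := measureDI mu mS mD.
by rewrite SD0 add0e.
Qed.

(** The law of Z s is the law, under a fixed product measure, of an explicit
    function of U, V and two independent paths; moments of Z s become iterated
    integrals. *)
Lemma rde_transfer (R : realType) d (T : measurableType d)
    (P : probability T R) (Z : R -> {RV P >-> R}) (s : R) (A : set R) :
  continuous_process Z -> solves_rde Z -> s \in `[0, 1] -> measurable A ->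
  P (Z s @^-1` A) = rde_law Z (rde_map s @^-1` A).
Proof.
move=> cZ [d' [T' [P' [U [V [Zc [uU uV ind lawZ rde]]]]]]] s01 mA.
have cylA : cylinder [set f : R -> R | A (f s)].
  by apply: sub_sigma_algebra; exists s => //; exists A.
pose ev k w := path_eval (rde_time s (U w)) (path_of (Zc k) w).
have evE k w : ev k w = path_of (Zc k) w (rde_time s (U w)).
  by rewrite /ev path_evalE//; [exact: rde_time01|have [+ _] := lawZ k; exact].
pose rhs w := rde_rhs (U w) (V w) (fun k => path_of (Zc k) w) s.
have -> : P (Z s @^-1` A) = P' (rhs @^-1` A) by exact: (rde _ cylA).
have mU : measurable_fun setT U by [].
have mV : measurable_fun setT V by [].
have mltU : measurable_fun setT (fun w => s < U w) by exact: measurable_fun_ltr.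
have mev k : measurable_fun setT (ev k).
  have mtime : measurable_fun setT (fun w => rde_time s (U w) : measurableTypeR R).
    by have h := measurableT_comp (measurable_rde_time s01) mU; exact: h.
  have mpair : measurable_fun setT (fun w : T' =>
      (rde_time s (U w) : measurableTypeR R, path_of (Zc k) w : path_space R)).
    by apply/measurable_fun_pairP; split => //; exact: measurable_path_of.
  by have h := measurableT_comp (@measurable_path_eval R) mpair; exact: h.
have mrhs : measurable_fun setT rhs.
  have -> : rhs = (fun w => if s < U w then
      (U w * V w) `^ beta_exp R * ev 0 w + (U w * (1 - V w)) `^ beta_exp R * ev 1 w
    else ((1 - U w) * V w) `^ beta_exp R * ev 2 w +
         ((1 - U w) * (1 - V w)) `^ beta_exp R * ev 3 w).
    by apply/funext => w; rewrite /rhs /rde_rhs !evE /rde_time; case: ifP.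
  have mp := @measurable_powR R (beta_exp R).
  have m1V : measurable_fun setT (fun w => 1 - V w) by exact: measurable_funB.
  have m1U : measurable_fun setT (fun w => 1 - U w) by exact: measurable_funB.
  apply: measurable_fun_ifT => //; apply: measurable_funD; apply: measurable_funM => //;
    by apply: (measurableT_comp mp); exact: measurable_funM.
have preT (f : T' -> R) (B : set R) : measurable_fun setT f -> measurable B ->
    measurable (f @^-1` B).
  by move=> mf mB; rewrite -[X in measurable X]setTI; exact: mf.
(* The factorised form of the combination needs V in [0, 1]: the null event
   where this fails is removed on both sides. *)
have mI : measurable (`[0, 1]%classic : set R) by [].
have PV : P' (V @^-1` `[0, 1]) = 1%E.
  by rewrite -(uniform_prob_unit R); exact: (uV _ mI).
have PVc : P' (~` (V @^-1` `[0, 1])) = 0%E.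
  by rewrite probability_setC ?PV ?subee//; exact: preT.
rewrite -(measureI_null (preT _ _ mrhs mA) (preT _ _ mV mI) PVc).
pose W i j w : rde_space R :=
  (U w, (V w, (path_of (Zc i) w, path_of (Zc j) w))).
have mW i j : measurable_fun setT (W i j).
  apply/measurable_fun_pairP; split; first exact: mU.
  apply/measurable_fun_pairP; split; first exact: mV.
  by apply/measurable_fun_pairP; split; exact: measurable_path_of.
have lawW i j S : i != j -> measurable S -> P' (W i j @^-1` S) = rde_law Z S.
  move=> ij mS; apply: rde_joint_law => // k; by have [] := lawZ k.
pose Om : set (rde_space R) :=
  [set z | z.2.1 \in `[0, 1] ].
pose L : set (rde_space R) :=
  [set z | s < z.1].
pose H := rde_map s @^-1` A.
have mH : measurable H.
  by rewrite -[X in measurable X]setTI; exact: measurable_rde_map.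
have mL : measurable L.
  rewrite (_ : L = fst @^-1` `]s, +oo[%classic).
    by rewrite -[X in measurable X]setTI; apply: measurable_fst.
  by apply/seteqP; split => z; rewrite /L /= in_itv/= andbT.
have mOm : measurable Om.
  rewrite (_ : Om = (fst \o snd) @^-1` `[0, 1]%classic)//.
  rewrite -[X in measurable X]setTI.
  by apply: (measurableT_comp measurable_fst measurable_snd).
have OmE : rde_law Z (~` Om) = 0%E.
  by rewrite -(@lawW 0 1)//; exact: measurableC.
have -> : rde_law Z H = rde_law Z (H `&` Om).
  exact/esym/measureI_null.
have -> : rde_law Z (H `&` Om) =
    (rde_law Z (H `&` Om `\` L) + rde_law Z (H `&` Om `&` L))%E.
  by apply: measureDI => //; exact: measurableI.
(* On s < U the equation uses the copies 0 and 1, elsewhere 2 and 3; either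
   pair, together with (U, V), has the law rde_law. *)
rewrite -(@lawW 2 3)//; last by apply: measurableD => //; exact: measurableI.
rewrite -(@lawW 0 1)//; last by apply: measurableI => //; exact: measurableI.
rewrite -measureU//.
- congr (P' _); apply/seteqP; split => w /=.
    move=> [rA V1]; have := rA; rewrite /rhs rde_rhsE// -!evE.
    by have [sU|sU] := ltP s (U w) => cA; [right|left]; split => //=; apply/negP;
      rewrite -leNgt.
  by case=> -[[rA V1] sU]; split => //; rewrite /rhs rde_rhsE// -!evE;
    [move/negP/negbTE: sU => ->|rewrite sU].
- rewrite -[X in measurable X]setTI; apply: mW => //.
  by apply: measurableD => //; exact: measurableI.
- rewrite -[X in measurable X]setTI; apply: mW => //.
  by apply: measurableI => //; exact: measurableI.
- by apply/seteqP; split => // w /= [[_ nL] [_ /nL]].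
Qed.

Lemma ge0_integral_rde (R : realType) d (T : measurableType d)
    (P : probability T R) (Z : R -> {RV P >-> R}) (s : R) (F : R -> \bar R) :
  continuous_process Z -> solves_rde Z -> s \in `[0, 1] ->
  measurable_fun setT F -> (forall x, 0 <= F x)%E ->
  (\int[P]_w F (Z s w) = \int[rde_law Z]_z F (rde_map s z))%E.
Proof.
move=> cZ rZ s01 mF F0.
have <- := @ge0_integral_distribution _ _ _ _ _ P (Z s) F mF F0.
have := @ge0_integral_pushforward _ _ _ _ _ _ (measurable_rde_map s01)
  (rde_law Z) setT F measurableT mF (fun x _ => F0 x).
rewrite preimage_setT => <-.
apply: eq_measure_integral => [|mR A mA _]; first exact: measurable_rde_map.
exact: rde_transfer cZ rZ s01 mA.
Qed.

Lemma integral_rde (R : realType) d (T : measurableType d)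
    (P : probability T R) (Z : R -> {RV P >-> R}) (s : R) (F : R -> \bar R) :
  continuous_process Z -> solves_rde Z -> s \in `[0, 1] ->
  measurable_fun setT F -> P.-integrable setT (fun w => F (Z s w)) ->
  (rde_law Z).-integrable setT (fun z => F (rde_map s z)) /\
  (\int[P]_w F (Z s w) = \int[rde_law Z]_z F (rde_map s z))%E.
Proof.
move=> cZ rZ s01 mF iF.
have iR : (rde_law Z).-integrable setT (fun z => F (rde_map s z)).
  apply/integrableP; split.
    by apply: measurableT_comp => //; exact: measurable_rde_map.
  rewrite -(@ge0_integral_rde _ _ _ _ _ _ (fun x => `|F x|)%E)//.
    by have /integrableP[] := iF.
  exact: measurableT_comp.
split => //.
have <- := @integral_distribution _ _ _ _ _ P (Z s) F mF iF.
have iR' : (rde_law Z).-integrable (rde_map s @^-1` setT) (F \o rde_map s).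
  by rewrite preimage_setT.
have := integral_pushforward (measurable_rde_map s01) mF iR' measurableT.
rewrite preimage_setT => <-.
apply: eq_measure_integral => [|mR A mA _]; first exact: measurable_rde_map.
exact: rde_transfer cZ rZ s01 mA.
Qed.

Lemma prod_probability1 (R : realType) d1 (T1 : measurableType d1)
    d2 (T2 : measurableType d2) (m1 : probability T1 R) (m2 : probability T2 R)
    (A : set T1) (B : set T2) : measurable A -> measurable B ->
  m1 A = 1%E -> m2 B = 1%E -> (m1 \x m2)%E (A `*` B) = 1%E.
Proof.
move=> mA mB A1 B1.
have -> : (m1 \x m2)%E (A `*` B) = (m1 A * m2 B)%E by exact: product_measure1E.
by rewrite A1 B1 mule1.
Qed.

(** The law of V and the two copies, once U is fixed. *)
Definition rde_inner_law (R : realType) d (T : measurableType d)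
    (P : probability T R) (Z : R -> {RV P >-> R}) :
    probability (measurableTypeR R * (path_space R * path_space R))%type R :=
  (uniform_prob (@ltr01 R) \x (path_law Z \x path_law Z))%E.

Lemma ae_rde_law_unit (R : realType) d (T : measurableType d)
    (P : probability T R) (Z : R -> {RV P >-> R}) :
  {ae rde_law Z, forall z, z.1 \in `[0, 1] /\ z.2.1 \in `[0, 1]}.
Proof.
have mI : measurable (`[0, 1]%classic : set (measurableTypeR R)) by [].
pose B : set (measurableTypeR R * (path_space R * path_space R)) :=
  `[0, 1]%classic `*` setT.
have mB : measurable B by apply: measurableX.
have B1 : rde_inner_law Z B = 1%E.
  apply: (@prod_probability1 R _ _ _ _ (uniform_prob (@ltr01 R))
    (path_law Z \x path_law Z)%E _ _ mI measurableT (uniform_prob_unit R)).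
  exact: probability_setT.
pose L : set (rde_space R) := `[0, 1]%classic `*` B.
have L1 : rde_law Z L = 1%E.
  exact: (@prod_probability1 R _ _ _ _ (uniform_prob (@ltr01 R))
    (rde_inner_law Z) _ _ mI mB (uniform_prob_unit R) B1).
have mL : measurable L by apply: measurableX.
exists (~` L); split.
- exact: measurableC.
- by apply: (etrans (probability_setC (rde_law Z) mL)); rewrite L1 subee.
- by move=> z /= nz [z1 [z2 _]]; apply: nz.
Qed.

Lemma integral_rde_law (R : realType) d (T : measurableType d)
    (P : probability T R) (Z : R -> {RV P >-> R}) (G : rde_space R -> \bar R) :
  (rde_law Z).-integrable setT G ->
  (\int[rde_law Z]_z G z = \int[uniform_prob (@ltr01 R)]_u
    \int[rde_inner_law Z]_y G (u, y))%E.
Proof.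
move=> iG.
by rewrite [LHS](esym (integral12_prod_meas1 iG)).
Qed.

Lemma integral_rde_law_integrable (R : realType) d (T : measurableType d)
    (P : probability T R) (Z : R -> {RV P >-> R}) (G : rde_space R -> \bar R) :
  (rde_law Z).-integrable setT G ->
  (uniform_prob (@ltr01 R)).-integrable setT
    (fun u => (\int[rde_inner_law Z]_y G (u, y))%E).
Proof.
move=> iG.
exact: (@integrable_fubini_F _ _ _ _ R (uniform_prob (@ltr01 R)) (rde_inner_law Z) G iG).
Qed.

(** * Powers of a sum of two independent copies *)

Lemma integrable_prodM (R : realType) d1 (T1 : measurableType d1)
    d2 (T2 : measurableType d2) (m1 : probability T1 R) (m2 : probability T2 R)
    (f : T1 -> R) (g : T2 -> R) :
  m1.-integrable setT (EFin \o f) -> m2.-integrable setT (EFin \o g) ->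
  (m1 \x m2)%E.-integrable setT (fun z => (f z.1 * g z.2)%:E) /\
  (\int[m1 \x m2]_z (f z.1 * g z.2)%:E =
   \int[m1]_x (f x)%:E * \int[m2]_y (g y)%:E)%E.
Proof.
move=> if1 ig2.
have mf : measurable_fun setT f by apply/measurable_EFinP; exact: measurable_int if1.
have mg : measurable_fun setT g by apply/measurable_EFinP; exact: measurable_int ig2.
have mfg : measurable_fun setT (fun z : T1 * T2 => (f z.1 * g z.2)%:E).
  apply/measurable_EFinP; apply: measurable_funM.
    exact: (measurableT_comp mf measurable_fst).
  exact: (measurableT_comp mg measurable_snd).
have mg' : measurable_fun setT (fun y => `|(g y)%:E|%E).
  exact: (measurableT_comp (@abse_measurable _ _) (measurable_int _ ig2)).
have mf' : measurable_fun setT (fun y => `|(f y)%:E|%E).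
  exact: (measurableT_comp (@abse_measurable _ _) (measurable_int _ if1)).
have Eg : (\int[m2]_y (g y)%:E)%E = (fine (\int[m2]_y (g y)%:E))%:E.
  by rewrite fineK//; exact: integrable_fin_num ig2.
have ifg : (m1 \x m2)%E.-integrable setT (fun z => (f z.1 * g z.2)%:E).
  apply: (proj2 (@integrable12ltyP _ _ _ _ _ m1 m2 _ mfg)).
  have e x : (\int[m2]_y `|(f x * g y)%:E| = `|(f x)%:E| * \int[m2]_y `|(g y)%:E|)%E.
    under eq_integral do rewrite EFinM abseM.
    by rewrite ge0_integralZl.
  under eq_integral do rewrite /= e.
  rewrite ge0_integralZr//; last by apply: integral_ge0.
  have /integrableP[_ foo] := if1; have /integrableP[_ goo] := ig2.
  by rewrite lte_mul_pinfty// ?integral_ge0// ge0_fin_numE ?integral_ge0.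
split => //.
rewrite -integral12_prod_meas1// /fubini_F/=.
have e x : (\int[m2]_y (f x * g y)%:E = (f x)%:E * \int[m2]_y (g y)%:E)%E.
  under eq_integral do rewrite EFinM.
  by rewrite integralZl.
under eq_integral do rewrite e Eg.
by rewrite integralZr// -Eg.
Qed.

Lemma integral_inner (R : realType) d (T : measurableType d)
    (P : probability T R) (Z : R -> {RV P >-> R}) (t : R) (a F G : R -> R) :
  continuous_process Z -> t \in `[0, 1] ->
  (uniform_prob (@ltr01 R)).-integrable setT (EFin \o a) ->
  measurable_fun setT F -> P.-integrable setT (fun w => (F (Z t w))%:E) ->
  measurable_fun setT G -> P.-integrable setT (fun w => (G (Z t w))%:E) ->
  let k := (fun y : measurableTypeR R * (path_space R * path_space R) =>
    a y.1 * (F (path_eval t y.2.1) * G (path_eval t y.2.2))) in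
  (rde_inner_law Z).-integrable setT (fun y => (k y)%:E) /\
  (\int[rde_inner_law Z]_y (k y)%:E = \int[uniform_prob (@ltr01 R)]_v (a v)%:E *
     (\int[P]_w (F (Z t w))%:E * \int[P]_w (G (Z t w))%:E))%E.
Proof.
move=> cZ t01 ia mF iF mG iG k.
have [iF' FE] := integral_path_eval cZ t01 mF iF.
have [iG' GE] := integral_path_eval cZ t01 mG iG.
have [iFG FGE] := integrable_prodM iF' iG'.
have [ik kE] := integrable_prodM ia iFG.
by split => //; rewrite kE FGE FE GE.
Qed.

(** Used with phi = id, and with the absolute value in the proof of positivity. *)
Definition fun_moment (R : realType) d (T : measurableType d)
    (P : probability T R) (Z : R -> {RV P >-> R}) (phi : R -> R) (l : nat) (t : R) : R :=
  fine (\int[P]_w (phi (Z t w) ^+ l)%:E)%E.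

Lemma fun_moment0 (R : realType) d (T : measurableType d)
    (P : probability T R) (Z : R -> {RV P >-> R}) (phi : R -> R) (t : R) :
  fun_moment Z phi 0 t = 1.
Proof.
by have := @expectation_cst _ _ _ P (1 : R); rewrite /fun_moment unlock => ->.
Qed.

(** The m-th moment of V^b X + (1 - V)^b Y when V is uniform, X and Y are
    independent, and both have moments c. *)
Definition mixed_moment_sum (R : realType) (c : nat -> R) (m : nat) : R :=
  \sum_(i < m.+1) 'C(m, i)%:R
    * Beta (beta_exp R * i%:R + 1) (beta_exp R * (m - i)%:R + 1)
    * c i * c (m - i)%N.

(** The extreme terms, which alone contain c m, are set apart: their Beta factors
    are both 1 / (b m + 1). *)
Lemma mixed_moment_sumE (R : realType) (c : nat -> R) (m : nat) : (0 < m)%N ->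
  mixed_moment_sum c m = 2 / (beta_exp R * m%:R + 1) * (c 0%N * c m) +
  \sum_(1 <= l < m) 'C(m, l)%:R * Beta (beta_exp R * l%:R + 1)
     (beta_exp R * (m - l)%:R + 1) * c l * c (m - l)%N.
Proof.
move=> m0; have bm : 0 < beta_exp R * m%:R.
  by rewrite mulr_gt0 ?ltr0n//; have /andP[] := beta_exp_bounds R; lra.
rewrite /mixed_moment_sum -(big_mkord xpredT (fun i => 'C(m, i)%:R
  * Beta (beta_exp R * i%:R + 1) (beta_exp R * (m - i)%:R + 1)
  * c i * c (m - i)%N)) big_ltn// big_nat_recr//=.
rewrite bin0 binn subn0 subnn mulr0 add0r Beta_1r// Beta_1l//; ring.
Qed.

Lemma exprn_scaled_add (R : comPzRingType) (r a x b y : R) (m : nat) :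
  (r * (a * x + b * y)) ^+ m =
  \sum_(i < m.+1) (r ^+ m * 'C(m, i)%:R) *
    ((a ^+ i * b ^+ (m - i)) * (x ^+ i * y ^+ (m - i))).
Proof.
rewrite exprMn addrC exprDn mulr_sumr; apply: eq_bigr => i _.
rewrite !exprMn -mulr_natr; ring.
Qed.

Lemma integral_exprn_scaled_add (R : realType) d (E : measurableType d)
    (mu : {measure set E -> \bar R}) (a x b y : E -> R) (r : R) (m : nat)
    (c : nat -> R) :
  (forall i, mu.-integrable setT (fun e =>
     ((a e ^+ i * b e ^+ (m - i)) * (x e ^+ i * y e ^+ (m - i)))%:E)) ->
  (forall i, \int[mu]_e
     ((a e ^+ i * b e ^+ (m - i)) * (x e ^+ i * y e ^+ (m - i)))%:E = (c i)%:E)%E ->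
  (\int[mu]_e ((r * (a e * x e + b e * y e)) ^+ m)%:E =
    (r ^+ m * \sum_(i < m.+1) 'C(m, i)%:R * c i)%:E)%E.
Proof.
move=> ik kE.
under eq_integral do rewrite exprn_scaled_add -sumEFin.
rewrite integral_sum//; last first.
  by move=> i; under eq_fun do rewrite EFinM; exact: integrableZl.
rewrite mulr_sumr -sumEFin; apply: eq_bigr => i _.
under eq_integral do rewrite EFinM.
by rewrite integralZl// kE -EFinM mulrA.
Qed.

(** In the binomial expansion each term is a product of a function of V, whose
    integral is a Beta value, and one function of each path. *)
Lemma integral_inner_exprn (R : realType) d (T : measurableType d)
    (P : probability T R) (Z : R -> {RV P >-> R}) (t r : R) (phi : R -> R) (m : nat) :
  continuous_process Z -> t \in `[0, 1] -> measurable_fun setT phi ->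
  (forall l, P.-integrable setT (fun w => (phi (Z t w) ^+ l)%:E)) ->
  (\int[rde_inner_law Z]_y ((r * (y.1 `^ beta_exp R * phi (path_eval t y.2.1) +
     (1 - y.1) `^ beta_exp R * phi (path_eval t y.2.2))) ^+ m)%:E =
  (r ^+ m * mixed_moment_sum (fun l => fun_moment Z phi l t) m)%:E)%E.
Proof.
move=> cZ t01 mphi iphi.
have b0 := beta_exp_ge0 R.
pose c i := Beta (beta_exp R * i%:R + 1) (beta_exp R * (m - i)%:R + 1) *
  (fun_moment Z phi i t * fun_moment Z phi (m - i) t).
have mX l : measurable_fun setT (fun x => phi x ^+ l) by exact: measurable_funX.
pose a i (v : R) := (v `^ beta_exp R) ^+ i * ((1 - v) `^ beta_exp R) ^+ (m - i).
have HA i : (uniform_prob (@ltr01 R)).-integrable setT (EFin \o a i) /\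
    (\int[uniform_prob (@ltr01 R)]_v (a i v)%:E =
     (Beta (beta_exp R * i%:R + 1) (beta_exp R * (m - i)%:R + 1))%:E)%E.
  have -> : a i = (fun v => v `^ (beta_exp R * i%:R) *
      (1 - v) `^ (beta_exp R * (m - i)%:R)).
    by apply/funext => v; rewrite /a !powR_exprn.
  by apply: Beta_uniform; rewrite mulr_ge0.
have H i := integral_inner cZ t01 (HA i).1 (mX i) (iphi i) (mX (m - i)%N) (iphi (m - i)%N).
have fE l : (\int[P]_w (phi (Z t w) ^+ l)%:E)%E = (fun_moment Z phi l t)%:E.
  by rewrite /fun_moment fineK//; exact: integrable_fin_num (iphi l).
have -> : mixed_moment_sum (fun l => fun_moment Z phi l t) m =
    \sum_(i < m.+1) 'C(m, i)%:R * c i.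
  by apply: eq_bigr => i _; rewrite /c !mulrA.
apply: (@integral_exprn_scaled_add R _ _ (rde_inner_law Z)
  (fun y => y.1 `^ beta_exp R) (fun y => phi (path_eval t y.2.1))
  (fun y => (1 - y.1) `^ beta_exp R) (fun y => phi (path_eval t y.2.2)) r m c) => i.
  exact: (H i).1.
by apply: (etrans (H i).2); rewrite (HA i).2 !fE -!EFinM.
Qed.

(** * The eigenfunctions of the moment recursion *)

(** With a = b m / 2 this is the m-th power of (s (1 - s))^(b/2). *)
Definition profile (R : realType) (a s : R) : R := (s * (1 - s)) `^ a.

Lemma profileX (R : realType) (m : nat) (s : R) :
  profile (beta_exp R / 2) s ^+ m = profile (beta_exp R * m%:R / 2) s.
Proof. by rewrite /profile powR_exprn; congr (_ `^ _); ring. Qed.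

Lemma profile_ge0 (R : realType) (a s : R) : 0 <= profile a s.
Proof. exact: powR_ge0. Qed.

Lemma profile_le1 (R : realType) (a s : R) : 0 <= a -> s \in `[0, 1] ->
  profile a s <= 1.
Proof.
move=> a0; rewrite in_itv/= => /andP[s0 s1]; apply: powR_le1 => //.
by rewrite mulr_ge0 ?subr_ge0//= mulr_ile1 ?subr_ge0// gerBl.
Qed.

(** rho^2 tau (1 - tau) is s (u - s) if s < u, and (1 - s) (s - u) otherwise. *)
Lemma rde_profileE (R : realType) (a s u : R) : 0 < a -> s \in `[0, 1] ->
  rde_scale s u `^ (2 * a) * profile a (rde_time s u) =
  if s < u then s `^ a * (u - s) `^ a else (1 - s) `^ a * (s - u) `^ a.
Proof.
move=> a0 s01; have := rde_time01 u s01; have := rde_scale_ge0 u s01.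
move: s01; rewrite !in_itv/= => /andP[s0 s1] r0 /andP[t0 t1].
have s1' : 0 <= 1 - s by rewrite subr_ge0.
rewrite powRrM powR_mulrn// /profile.
rewrite -powRM ?exprn_ge0 ?mulr_ge0 ?subr_ge0//.
move: r0; rewrite /rde_scale /rde_time; case: ltP => su r0.
  have u0 : u != 0 by rewrite gt_eqF// (le_lt_trans s0).
  by rewrite -powRM ?subr_ge0 ?(ltW su)//; congr (_ `^ _); field.
rewrite -powRM ?subr_ge0//; congr (_ `^ _).
have [u1|u1] := eqVneq u 1.
  have -> : s = 1 by apply/eqP; rewrite eq_le s1 -u1.
  by rewrite u1 !subrr expr0n/= !mul0r.
have u10 : 1 - u != 0 by rewrite subr_eq0 eq_sym.
by field.
Qed.

Lemma measurable_rde_profile (R : realType) (a s : R) : s \in `[0, 1] ->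
  measurable_fun setT (fun u => rde_scale s u `^ (2 * a) * profile a (rde_time s u)).
Proof.
move=> s01; have mt := measurable_rde_time s01.
apply: measurable_funM.
  exact: (measurableT_comp (@measurable_powR R (2 * a)) (@measurable_rde_scale R s)).
apply: (measurableT_comp (@measurable_powR R a)); apply: measurable_funM => //.
exact: measurable_funB.
Qed.

(** The profile is an eigenfunction: by the preceding formula the integral over
    u > s is s^a (1 - s)^(a+1) / (a + 1), and symmetrically for u <= s. *)
Lemma integral_rde_profile (R : realType) (a s : R) : 0 < a -> s \in `[0, 1] ->
  (\int[uniform_prob (@ltr01 R)]_u
    (rde_scale s u `^ (2 * a) * profile a (rde_time s u))%:E =
   (profile a s / (a + 1))%:E)%E.
Proof.
move=> a0 s01; have := s01; rewrite in_itv/= => /andP[s0 s1].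
have a1 : a + 1 != 0 by rewrite gt_eqF// addr_gt0.
rewrite integral_uniform//; last 2 first.
- by apply/measurable_EFinP; exact: measurable_rde_profile.
- by move=> u; rewrite lee_fin mulr_ge0 ?powR_ge0.
rewrite subr0 invr1 mul1e.
under eq_integral do rewrite rde_profileE//.
pose k (u : R) := if s < u then s `^ a * (u - s) `^ a else (1 - s) `^ a * (s - u) `^ a.
have mk : measurable_fun setT (EFin \o k).
  apply/measurable_EFinP; apply: measurable_fun_ifT; first exact: measurable_fun_ltr.
    apply: measurable_funM => //; apply: (measurableT_comp (@measurable_powR R a)).
    exact: measurable_funB.
  apply: measurable_funM => //; apply: (measurableT_comp (@measurable_powR R a)).
  exact: measurable_funB.
have k0 u : (0 <= (k u)%:E)%E.
  by rewrite lee_fin /k; case: ifP; rewrite mulr_ge0 ?powR_ge0.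
have itvU : `[0, 1]%classic = `[0, s]%classic `|` `]s, 1]%classic :> set R.
  by rewrite -itv_bndbnd_setU// bnd_simp.
rewrite itvU ge0_integral_setU//=; last 3 first.
- exact: measurable_funTS mk.
- by move=> u _; exact: k0.
- apply/disj_setPS => x [/=]; rewrite !in_itv/= => /andP[_ xs] /andP[sx _].
  by move: sx; rewrite ltNge xs.
rewrite (eq_integral (fun u : measurableTypeR R => ((1 - s) `^ a)%:E * ((s - u) `^ a)%:E)%E); last first.
  by move=> u; rewrite inE/= in_itv/= => /andP[_ us]; rewrite ltNge us.
rewrite [X in (_ + X)%E](eq_integral (fun u : measurableTypeR R => (s `^ a)%:E * ((u - s) `^ a)%:E)%E); last first.
  by move=> u; rewrite inE/= in_itv/= => /andP[su _]; rewrite su.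
have mr c : measurable_fun setT (fun x : R => ((c - x) `^ a)%:E).
  apply/measurable_EFinP; apply: (measurableT_comp (@measurable_powR R a)).
  exact: measurable_funB.
have ml c : measurable_fun setT (fun x : R => ((x - c) `^ a)%:E).
  apply/measurable_EFinP; apply: (measurableT_comp (@measurable_powR R a)).
  exact: measurable_funB.
rewrite !ge0_integralZl//; last 6 first.
- exact: measurable_funTS (ml s).
- by move=> x _; rewrite lee_fin powR_ge0.
- by rewrite lee_fin powR_ge0.
- exact: measurable_funTS (mr s).
- by move=> x _; rewrite lee_fin powR_ge0.
- by rewrite lee_fin powR_ge0.
rewrite integral_itv_obnd_cbnd; last exact: measurable_funTS (ml s).
rewrite integral_powR_subr_le// integral_powR_subl_le// subr0 -!EFinM -EFinD.
congr EFin; rewrite /profile powRM ?subr_ge0//.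
(* s^a (1-s)^(a+1) + (1-s)^a s^(a+1) = s^a (1-s)^a. *)
have p1 (x : R) : 0 <= x -> x `^ (a + 1) = x * x `^ a.
  by move=> x0; rewrite -mulr_powRB1 ?addrK// addr_gt0.
by rewrite !p1 ?subr_ge0//; field.
Qed.

Lemma integral_rde_profileX (R : realType) (m : nat) (s c : R) : (0 < m)%N ->
  s \in `[0, 1] ->
  (uniform_prob (@ltr01 R)).-integrable setT (fun u =>
     ((rde_scale s u `^ beta_exp R) ^+ m * (c * profile (beta_exp R / 2) (rde_time s u) ^+ m))%:E) /\
  (\int[uniform_prob (@ltr01 R)]_u
     ((rde_scale s u `^ beta_exp R) ^+ m * (c * profile (beta_exp R / 2) (rde_time s u) ^+ m))%:E =
   (c * profile (beta_exp R / 2) s ^+ m / (beta_exp R * m%:R / 2 + 1))%:E)%E.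
Proof.
move=> m0 s01; pose a := beta_exp R * m%:R / 2.
have a0 : 0 < a.
  by rewrite divr_gt0// mulr_gt0 ?ltr0n//; have /andP[] := beta_exp_bounds R; lra.
pose k u := rde_scale s u `^ (2 * a) * profile a (rde_time s u).
have kE : (fun u => ((rde_scale s u `^ beta_exp R) ^+ m *
    (c * profile (beta_exp R / 2) (rde_time s u) ^+ m))%:E) = (fun u => c%:E * (k u)%:E)%E.
  apply/funext => u; rewrite profileX powR_exprn -EFinM /k /a; congr EFin.
  have -> : 2 * (beta_exp R * m%:R / 2) = beta_exp R * m%:R by field.
  by ring.
have kI := integral_rde_profile a0 s01.
have ik : (uniform_prob (@ltr01 R)).-integrable setT (EFin \o k).
  apply/integrableP; split.
    by apply/measurable_EFinP; exact: measurable_rde_profile.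
  under eq_integral do rewrite gee0_abs ?lee_fin ?mulr_ge0 ?powR_ge0//.
  by rewrite [X in (X < _)%E]kI; exact: ltry.
rewrite kE; split; first exact: integrableZl.
by rewrite integralZl// [X in (_ * X)%E]kI -EFinM mulrA profileX.
Qed.

(** * Boundedness of all moments *)

(** The supremum S of f over A is finite, and the improvement step applied to it
    reads S <= k S + C. *)
Lemma contraction_bound (R : realType) (A : set R) (f : R -> R) (k C : R) :
  k < 1 -> (exists D, forall s, A s -> f s <= D) ->
  (forall D, (forall s, A s -> f s <= D) -> forall s, A s -> f s <= k * D + C) ->
  forall s, A s -> f s <= C / (1 - k).
Proof.
move=> k1 [D0 fD0] step s As.
have hs : has_sup (f @` A).
  split; first by exists (f s), s.
  by exists D0 => _ [t At <-]; exact: fD0.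
have fsup t : A t -> f t <= sup (f @` A).
  by move=> At; apply: (sup_upper_bound hs); exists t.
have : sup (f @` A) <= k * sup (f @` A) + C.
  apply: ge_sup; first by exists (f s), s.
  by move=> _ [t At <-]; exact: step.
have := fsup s As; set S := sup _ => fS SS.
apply: (le_trans fS); rewrite ler_pdivlMr ?subr_gt0//; lra.
Qed.

(** The power x^(p+1) with one of its factors cut at K: its expectation is finite
    as soon as the moment of order p is. *)
Definition trunc_power (R : realType) (K : R) (p : nat) (x : R) : R :=
  x ^+ p * Num.min x K.

(** The binomial expansion of (x + y)^(p+1) without its two extreme terms: no
    exponent exceeds p. *)
Definition mixed_terms (R : realType) (p : nat) (x y : R) : R :=
  \sum_(i < p) 'C(p.+1, i.+1)%:R * (x ^+ i.+1 * y ^+ (p - i)).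

Lemma mixed_termsE (R : realType) (p : nat) (x y : R) :
  mixed_terms p x y = (x + y) ^+ p.+1 - x ^+ p.+1 - y ^+ p.+1.
Proof.
rewrite [x + y]addrC exprDn big_ord_recl big_ord_recr/= subn0 subnn.
rewrite !expr0 mulr1 mul1r bin0 mulr1n /bump/= add1n binn mulr1n.
rewrite [RHS](_ : _ = \sum_(i < p) (y ^+ (p.+1 - bump 0 i) * x ^+ bump 0 i) *+
   'C(p.+1, bump 0 i)); last by ring.
apply: eq_bigr => i _; rewrite /bump/= add1n subSS -mulr_natl; ring.
Qed.

Lemma ler_mixed_terms (R : realType) (p : nat) (x y x' y' : R) :
  0 <= x <= x' -> 0 <= y <= y' -> mixed_terms p x y <= mixed_terms p x' y'.
Proof.
move=> /andP[x0 xx] /andP[y0 yy]; apply: ler_sum => i _.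
have x'0 := le_trans x0 xx; have y'0 := le_trans y0 yy.
by rewrite ler_wpM2l// ler_pM ?exprn_ge0// lerXn2r ?nnegrE.
Qed.

Lemma trunc_power_ge0 (R : realType) (K : R) p (x : R) : 0 <= K -> 0 <= x ->
  0 <= trunc_power K p x.
Proof. by move=> K0 x0; rewrite mulr_ge0 ?exprn_ge0// le_min x0. Qed.

Lemma ler_trunc_power (R : realType) (K : R) p (x y : R) : 0 <= K ->
  0 <= x <= y -> trunc_power K p x <= trunc_power K p y.
Proof.
move=> K0 /andP[x0 xy]; rewrite ler_pM ?exprn_ge0 ?le_min ?x0//.
  by rewrite lerXn2r ?nnegrE// (le_trans x0).
by rewrite ge_min xy ge_min lexx orbT.
Qed.

Lemma trunc_power_le (R : realType) (K : R) p (x : R) : 0 <= x ->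
  trunc_power K p x <= K * x ^+ p.
Proof.
by move=> x0; rewrite /trunc_power mulrC ler_wpM2r ?exprn_ge0// ge_min lexx orbT.
Qed.

Lemma trunc_powerZ (R : realType) (K : R) p (a x : R) : 0 <= K -> 0 <= a <= 1 -> 0 <= x ->
  trunc_power K p (a * x) <= a ^+ p * trunc_power K p x.
Proof.
move=> K0 /andP[a0 a1] x0; rewrite /trunc_power exprMn -mulrA.
rewrite ler_wpM2l ?exprn_ge0// ler_wpM2l ?exprn_ge0//.
by rewrite le_min !ge_min ler_piMl// lexx orbT.
Qed.

(** Cutting a single factor leaves mixed terms that do not involve K and have
    degree at most p in each variable. *)
Lemma trunc_powerD (R : realType) (K : R) p (x y : R) : 0 <= K -> 0 <= x -> 0 <= y ->
  trunc_power K p (x + y) <= trunc_power K p x + trunc_power K p y + mixed_terms p x y.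
Proof.
move=> K0 x0 y0; rewrite mixed_termsE /trunc_power !exprSr.
have mxy : Num.min (x + y) K <= Num.min x K + Num.min y K.
  by rewrite !minEle; case: ifP; case: ifP; case: ifP; lra.
have mx : Num.min x K <= x by rewrite ge_min lexx.
have my : Num.min y K <= y by rewrite ge_min lexx.
have px : x ^+ p <= (x + y) ^+ p by rewrite lerXn2r ?nnegrE ?addr_ge0// lerDl.
have py : y ^+ p <= (x + y) ^+ p by rewrite lerXn2r ?nnegrE ?addr_ge0// lerDr.
have p0 : 0 <= (x + y) ^+ p by rewrite exprn_ge0 ?addr_ge0.
apply: (@le_trans _ _ ((x + y) ^+ p * (Num.min x K + Num.min y K))).
  by rewrite ler_wpM2l.
have h1 := mulr_ge0 (_ : 0 <= (x + y) ^+ p - x ^+ p) (_ : 0 <= x - Num.min x K).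
have h2 := mulr_ge0 (_ : 0 <= (x + y) ^+ p - y ^+ p) (_ : 0 <= y - Num.min y K).
rewrite !subr_ge0 in h1, h2; have := h1 px mx; have := h2 py my; lra.
Qed.

(** The factor r is at most 1 and can be dropped. Only p of the p + 1 factors a are
    kept, since the cut factor min(a x, K) does not scale. *)
Lemma trunc_power_comb (R : realType) (K : R) (p : nat) (r a b x y : R) :
  0 <= K -> 0 <= r <= 1 -> 0 <= a <= 1 -> 0 <= b <= 1 ->
  trunc_power K p `|r * (a * x + b * y)| <=
  a ^+ p * trunc_power K p `|x| + b ^+ p * trunc_power K p `|y|
    + mixed_terms p `|x| `|y|.
Proof.
move=> K0 /andP[r0 r1] /andP[a0 a1] /andP[b0 b1].
apply: (@le_trans _ _ (trunc_power K p (a * `|x| + b * `|y|))).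
  apply: ler_trunc_power => //; rewrite normr_ge0 normrM ger0_norm//=.
  apply: (@le_trans _ _ `|a * x + b * y|); first by rewrite ler_piMl.
  by rewrite (le_trans (ler_normD _ _))// !normrM (ger0_norm a0) (ger0_norm b0).
apply: le_trans (trunc_powerD _ _ _ _) _ => //; rewrite ?mulr_ge0//.
rewrite lerD ?lerD ?trunc_powerZ ?a0 ?b0//.
by apply: ler_mixed_terms; rewrite mulr_ge0// ler_piMl.
Qed.

Lemma integral_trunc_bound (R : realType) d (E : measurableType d)
    (mu : {measure set E -> \bar R}) (A B : E -> R) (S : nat -> E -> R) (p : nat)
    (alpha beta : R) (sigma : nat -> R) :
  mu.-integrable setT (EFin \o A) -> mu.-integrable setT (EFin \o B) ->
  (forall i, (i < p)%N -> mu.-integrable setT (EFin \o S i)) ->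
  (\int[mu]_e (A e)%:E <= alpha%:E)%E -> (\int[mu]_e (B e)%:E <= beta%:E)%E ->
  (forall i, (i < p)%N -> \int[mu]_e (S i e)%:E <= (sigma i)%:E)%E ->
  (\int[mu]_e (A e + B e + \sum_(i < p) 'C(p.+1, i.+1)%:R * S i e)%:E
    <= (alpha + beta + \sum_(i < p) 'C(p.+1, i.+1)%:R * sigma i)%:E)%E.
Proof.
move=> iA iB iS Aa Bb Ss.
have iC (i : 'I_p) : mu.-integrable setT (fun e => ('C(p.+1, i.+1)%:R * S i e)%:E).
  by under eq_fun do rewrite EFinM; apply: (integrableZl measurableT _ (iS i (ltn_ord i))).
under eq_integral do rewrite !EFinD -sumEFin.
rewrite integralD//; last 2 first.
- exact: integrableD.
- by apply: integrable_sum => // i _; exact: iC.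
rewrite integralD// integral_sum//.
rewrite !EFinD -sumEFin !leeD//; apply: lee_sum => i _.
under eq_integral do rewrite EFinM.
rewrite integralZl//; last exact: (iS i (ltn_ord i)).
by rewrite EFinM lee_pmul2l// ?lte_fin ?Ss// ltr0n bin_gt0 ltnS ltnW.
Qed.

Definition moments_le (R : realType) d (T : measurableType d)
    (P : probability T R) (Z : R -> {RV P >-> R}) (p : nat) (M : R) : Prop :=
  forall l t, (l <= p)%N -> t \in `[0, 1] ->
    (\int[P]_w (`|Z t w| ^+ l)%:E <= M%:E)%E.

Definition has_bounded_moments (R : realType) d (T : measurableType d)
    (P : probability T R) (Z : R -> {RV P >-> R}) : Prop :=
  forall p, exists M : R, moments_le Z p M.

(** The expectations of V^(b p) and (1 - V)^(b p) are 1 / (b p + 1), and the mixed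
    terms are products of moments of order at most p. *)
Lemma integral_inner_trunc (R : realType) d (T : measurableType d)
    (P : probability T R) (Z : R -> {RV P >-> R}) (p : nat) (K D M t : R) :
  continuous_process Z -> t \in `[0, 1] -> (0 < p)%N -> 0 <= K ->
  (forall l, (l <= p)%N -> (\int[P]_w (`|Z t w| ^+ l)%:E <= M%:E)%E) ->
  (\int[P]_w (trunc_power K p `|Z t w|)%:E <= D%:E)%E ->
  (\int[rde_inner_law Z]_y
     ((y.1 `^ beta_exp R) ^+ p * trunc_power K p `|path_eval t y.2.1| +
     ((1 - y.1) `^ beta_exp R) ^+ p * trunc_power K p `|path_eval t y.2.2| +
     mixed_terms p `|path_eval t y.2.1| `|path_eval t y.2.2|)%:E <=
   ((beta_exp R * p%:R + 1)^-1 * D + (beta_exp R * p%:R + 1)^-1 * D +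
    \sum_(i < p) 'C(p.+1, i.+1)%:R * (M * M))%:E)%E.
Proof.
move=> cZ t01 p0 K0 hM hD.
have bp0 : 0 < beta_exp R * p%:R.
  by rewrite mulr_gt0 ?ltr0n//; have /andP[] := beta_exp_bounds R; lra.
have mZ : measurable_fun setT (Z t) by [].
have mnX l : measurable_fun setT (fun x : R => `|x| ^+ l).
  by apply: measurable_funX; exact: normr_measurable.
have mtr : measurable_fun setT (fun x : R => trunc_power K p `|x|).
  by apply: measurable_funM => //; apply: measurable_minr => //; exact: normr_measurable.
have ge0_int (F : R -> R) (c : R) : measurable_fun setT F -> (forall x, 0 <= F x) ->
    (\int[P]_w (F (Z t w))%:E <= c%:E)%E ->
    P.-integrable setT (fun w => (F (Z t w))%:E).
  move=> mF F0 Fc; apply/integrableP; split.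
    by apply/measurable_EFinP; exact: measurableT_comp.
  under eq_integral do rewrite gee0_abs ?lee_fin//.
  exact: le_lt_trans Fc (ltry c).
have itr := ge0_int _ _ mtr (fun x => trunc_power_ge0 p K0 (normr_ge0 x)) hD.
have iX l : (l <= p)%N -> P.-integrable setT (fun w => (`|Z t w| ^+ l)%:E).
  move=> lp; apply: (ge0_int (fun x => `|x| ^+ l) M) => [//|x|]; last exact: hM.
  by rewrite exprn_ge0.
have i1 : P.-integrable setT (fun w => ((cst 1 : R -> R) (Z t w))%:E).
  exact: finite_measure_integrable_cst.
have E1 : (\int[P]_w ((cst 1 : R -> R) (Z t w))%:E = 1%:E)%E.
  exact: integral_probability_cst.
pose a (v : R) := (v `^ beta_exp R) ^+ p.
pose b (v : R) := ((1 - v) `^ beta_exp R) ^+ p.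
have aE : a = (fun v => v `^ (beta_exp R * p%:R) * (1 - v) `^ 0).
  by apply/funext => v; rewrite /a powR_exprn powRr0 mulr1.
have bE : b = (fun v => v `^ 0 * (1 - v) `^ (beta_exp R * p%:R)).
  by apply/funext => v; rewrite /b powR_exprn powRr0 mul1r.
have [ia ea] : (uniform_prob (@ltr01 R)).-integrable setT (EFin \o a) /\
    (\int[uniform_prob (@ltr01 R)]_v (a v)%:E = ((beta_exp R * p%:R + 1)^-1)%:E)%E.
  by rewrite aE -Beta_1r// -[X in Beta _ X]add0r; apply: Beta_uniform; [exact: ltW|].
have [ib eb] : (uniform_prob (@ltr01 R)).-integrable setT (EFin \o b) /\
    (\int[uniform_prob (@ltr01 R)]_v (b v)%:E = ((beta_exp R * p%:R + 1)^-1)%:E)%E.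
  by rewrite bE -Beta_1l// -[X in Beta X _]add0r; apply: Beta_uniform; [|exact: ltW].
have iu : (uniform_prob (@ltr01 R)).-integrable setT (EFin \o (cst 1 : R -> R)).
  exact: finite_measure_integrable_cst.
have eu : (\int[uniform_prob (@ltr01 R)]_v ((cst 1 : R -> R) v)%:E = 1%:E)%E.
  exact: integral_probability_cst.
have c0 : 0 <= (beta_exp R * p%:R + 1)^-1 by rewrite invr_ge0 addr_ge0 ?ltW.
have [iA eA] := integral_inner cZ t01 ia mtr itr (@measurable_cst _ _ _ _ setT (1:R)) i1.
have [iB eB] := integral_inner cZ t01 ib (@measurable_cst _ _ _ _ setT (1:R)) i1 mtr itr.
have HS i : (i < p)%N -> _ := fun ip => integral_inner cZ t01 iu
  (mnX i.+1) (iX i.+1 ip) (mnX (p - i)%N) (iX (p - i)%N (leq_subr _ _)).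
have := @integral_trunc_bound R _ _ (rde_inner_law Z)
  (fun y => a y.1 * (trunc_power K p `|path_eval t y.2.1| * 1))
  (fun y => b y.1 * (1 * trunc_power K p `|path_eval t y.2.2|))
  (fun i y => 1 * (`|path_eval t y.2.1| ^+ i.+1 * `|path_eval t y.2.2| ^+ (p - i)))
  p ((beta_exp R * p%:R + 1)^-1 * D) ((beta_exp R * p%:R + 1)^-1 * D) (fun=> M * M) iA iB
  (fun i ip => (HS i ip).1).
have hA : (\int[rde_inner_law Z]_y
    (a y.1 * (trunc_power K p `|path_eval t y.2.1| * 1))%:E <=
    ((beta_exp R * p%:R + 1)^-1 * D)%:E)%E.
  rewrite [X in (X <= _)%E]eA ea E1 mule1 EFinM.
  by apply: lee_wpmul2l => //; rewrite lee_fin.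
have hB : (\int[rde_inner_law Z]_y
    (b y.1 * (1 * trunc_power K p `|path_eval t y.2.2|))%:E <=
    ((beta_exp R * p%:R + 1)^-1 * D)%:E)%E.
  rewrite [X in (X <= _)%E]eB eb E1 mul1e EFinM.
  by apply: lee_wpmul2l => //; rewrite lee_fin.
have hS i : (i < p)%N -> (\int[rde_inner_law Z]_y
    (1 * (`|path_eval t y.2.1| ^+ i.+1 * `|path_eval t y.2.2| ^+ (p - i)))%:E <=
    (M * M)%:E)%E.
  move=> ip; rewrite [X in (X <= _)%E](HS i ip).2 eu mul1e EFinM.
  apply: lee_pmul; try (by apply: integral_ge0 => w _; rewrite lee_fin exprn_ge0).
    exact: hM.
  exact/hM/leq_subr.
move=> /(_ hA hB hS); apply: le_trans; rewrite le_eqVlt; apply/orP; left; apply/eqP.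
apply: eq_integral => y _; congr EFin; rewrite mulr1 mul1r; congr (_ + _).
by apply: eq_bigr => i _; rewrite mul1r.
Qed.

Lemma integral_trunc_rde (R : realType) d (T : measurableType d)
    (P : probability T R) (Z : R -> {RV P >-> R}) (p : nat) (K D M s : R) :
  continuous_process Z -> solves_rde Z -> s \in `[0, 1] -> (0 < p)%N -> 0 <= K ->
  moments_le Z p M ->
  (forall t, t \in `[0, 1] -> (\int[P]_w (trunc_power K p `|Z t w|)%:E <= D%:E)%E) ->
  (\int[P]_w (trunc_power K p `|Z s w|)%:E <=
   ((beta_exp R * p%:R + 1)^-1 * D + (beta_exp R * p%:R + 1)^-1 * D +
    \sum_(i < p) 'C(p.+1, i.+1)%:R * (M * M))%:E)%E.
Proof.
move=> cZ rZ s01 p0 K0 hM hD.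
have mtr : measurable_fun setT (fun x : R => trunc_power K p `|x|).
  apply: measurable_funM.
    by apply: measurable_funX; exact: normr_measurable.
  by apply: measurable_minr => //; exact: normr_measurable.
have tr0 x : 0 <= trunc_power K p `|x| by exact: trunc_power_ge0.
rewrite (ge0_integral_rde (F := fun x => (trunc_power K p `|x|)%:E) cZ rZ s01); last 2 first.
- exact/measurable_EFinP.
- by move=> x; rewrite lee_fin.
pose X (z : rde_space R) := path_eval (rde_time s z.1) z.2.2.1.
pose Y (z : rde_space R) := path_eval (rde_time s z.1) z.2.2.2.
have mX : measurable_fun setT X by exact: (measurable_rde_eval s01 measurable_fst).
have mY : measurable_fun setT Y by exact: (measurable_rde_eval s01 measurable_snd).
pose B (z : rde_space R) := (z.2.1 `^ beta_exp R) ^+ p * trunc_power K p `|X z| +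
     ((1 - z.2.1) `^ beta_exp R) ^+ p * trunc_power K p `|Y z| +
     mixed_terms p `|X z| `|Y z|.
have B0 z : 0 <= B z.
  apply: addr_ge0; last first.
    by apply: sumr_ge0 => i _; rewrite !mulr_ge0 ?exprn_ge0.
  by apply: addr_ge0; apply: mulr_ge0; rewrite ?exprn_ge0 ?powR_ge0 ?tr0.
have mB : measurable_fun setT B.
  have m1 : measurable_fun setT (fun z : rde_space R => z.2.1).
    exact: (measurableT_comp measurable_fst measurable_snd).
  have mp := @measurable_powR R (beta_exp R).
  have mnX : measurable_fun setT (fun z => `|X z|).
    exact: (measurableT_comp (@normr_measurable R setT) mX).
  have mnY : measurable_fun setT (fun z => `|Y z|).
    exact: (measurableT_comp (@normr_measurable R setT) mY).
  apply: measurable_funD; first apply: measurable_funD; first apply: measurable_funM.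
  - apply: measurable_funX; exact: (measurableT_comp mp m1).
  - exact: (measurableT_comp mtr mX).
  - apply: measurable_funM; last exact: (measurableT_comp mtr mY).
    apply: measurable_funX; apply: (measurableT_comp mp).
    by apply: measurable_funB => //; exact: m1.
  - apply: measurable_sum => i; apply: measurable_funM => //.
    by apply: measurable_funM; apply: measurable_funX.
apply: (@le_trans _ _ (\int[rde_law Z]_z (B z)%:E)%E).
  apply: ae_ge0_le_integral => //.
  - by move=> z _; rewrite lee_fin.
  - apply/measurable_EFinP; apply: (measurableT_comp mtr); exact: measurable_rde_map.
  - by move=> z _; rewrite lee_fin.
  - exact/measurable_EFinP.
  - have [N [mN N0 subN]] := ae_rde_law_unit Z.
    exists N; split => // z /= nz; apply: subN => /= -[z1 z2]; apply: nz => _.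
    rewrite lee_fin; apply: trunc_power_comb => //.
    + by rewrite powR_ge0 powR_le1 ?beta_exp_ge0// rde_scale_ge0// rde_scale_le1.
    + by rewrite powR_ge0 powR_le1 ?beta_exp_ge0//; rewrite in_itv in z2.
    + rewrite powR_ge0 powR_le1 ?beta_exp_ge0//; move: z2; rewrite in_itv/=.
      by move=> /andP[v0 v1]; rewrite subr_ge0 v1 gerBl.
have mBE : measurable_fun setT (EFin \o B) by exact/measurable_EFinP.
have -> : (\int[rde_law Z]_z (B z)%:E = \int[uniform_prob (@ltr01 R)]_u
    \int[rde_inner_law Z]_y (B (u, y))%:E)%E.
  exact: (@fubini_tonelli1 _ _ _ _ R (uniform_prob (@ltr01 R)) (rde_inner_law Z)
    (EFin \o B) mBE (fun z => B0 z)).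
set c := (X in (_ <= X%:E)%E).
have cE : (\int[uniform_prob (@ltr01 R)]_u (cst c%:E u) = c%:E)%E.
  exact: integral_probability_cst.
rewrite -cE; apply: ge0_le_integral => //.
- by move=> u _; apply: integral_ge0 => y _; rewrite lee_fin.
- exact: (@measurable_fun_fubini_tonelli_F _ _ _ _ R (rde_inner_law Z)
    (EFin \o B) mBE (fun z => B0 z)).
- move=> u _; have t01 := rde_time01 u s01.
  exact: (@integral_inner_trunc R _ T P Z p K D M (rde_time s u) cZ t01 p0 K0
    (fun l lp => hM l _ lp t01) (hD _ t01)).
Qed.

(** The bound D on the truncated moments is improved by the equation to k D + C
    with k < 1 and C independent of K, so they are at most C / (1 - k). Monotone
    convergence then removes the truncation. *)
Lemma moment_step (R : realType) d (T : measurableType d)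
    (P : probability T R) (Z : R -> {RV P >-> R}) (p : nat) (M : R) :
  continuous_process Z -> solves_rde Z -> (1 < p)%N ->
  moments_le Z p M ->
  exists M', forall t, t \in `[0, 1] -> (\int[P]_w (`|Z t w| ^+ p.+1)%:E <= M'%:E)%E.
Proof.
move=> cZ rZ p1 hM.
have mtr K : measurable_fun setT (fun x : R => trunc_power K p `|x|).
  apply: measurable_funM.
    by apply: measurable_funX; exact: normr_measurable.
  by apply: measurable_minr => //; exact: normr_measurable.
pose G n t := fine (\int[P]_w (trunc_power n%:R p `|Z t w|)%:E)%E.
have tr0 n t w : (0 <= (trunc_power n%:R p `|Z t w|)%:E)%E.
  by rewrite lee_fin trunc_power_ge0.
have mtrZ n t : measurable_fun setT (fun w => (trunc_power n%:R p `|Z t w|)%:E).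
  by apply/measurable_EFinP; apply: (measurableT_comp (mtr n%:R)).
have Gle n t : t \in `[0, 1] ->
    (\int[P]_w (trunc_power n%:R p `|Z t w|)%:E <= (n%:R * M)%:E)%E.
  move=> t01; have mnp : measurable_fun setT (fun w => (`|Z t w| ^+ p)%:E).
    apply/measurable_EFinP; apply: measurable_funX.
    by apply: measurableT_comp => //; exact: normr_measurable.
  apply: (@le_trans _ _ (\int[P]_w (n%:R%:E * (`|Z t w| ^+ p)%:E))%E).
    apply: ge0_le_integral => //.
    - exact: emeasurable_funM.
    - by move=> w _; rewrite -EFinM lee_fin trunc_power_le.
  rewrite ge0_integralZl//.
  by rewrite EFinM; apply: lee_wpmul2l; rewrite ?lee_fin// hM.
have GE n t : t \in `[0, 1] ->
    (\int[P]_w (trunc_power n%:R p `|Z t w|)%:E = (G n t)%:E)%E.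
  move=> t01; rewrite /G fineK// ge0_fin_numE ?integral_ge0//.
  exact: le_lt_trans (Gle n t t01) (ltry _).
(* k < 1 because p >= 2 and the exponent exceeds 1/2. *)
pose k := (beta_exp R * p%:R + 1)^-1 * 2.
have k1 : k < 1.
  rewrite /k; have /andP[b0 _] := beta_exp_bounds R.
  have p2 : 2 <= p%:R :> R by rewrite ler_nat.
  by rewrite mulrC ltr_pdivrMr; nra.
pose C := \sum_(i < p) 'C(p.+1, i.+1)%:R * (M * M).
exists (C / (1 - k)) => t t01.
have Gb n s : s \in `[0, 1] -> G n s <= C / (1 - k).
  apply: (@contraction_bound _ [set s | s \in `[0, 1]] (G n)) => //.
    by exists (n%:R * M) => u u01; rewrite -lee_fin -GE//; exact: Gle.
  move=> D hD u u01; rewrite -lee_fin -GE//.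
  apply: le_trans (integral_trunc_rde (K := n%:R) (D := D) cZ rZ u01 (ltnW p1) _ hM _) _ => //.
    by move=> v v01; rewrite GE// lee_fin hD.
  by rewrite lee_fin /k /C; lra.
have h : (\int[P]_w (trunc_power n%:R p `|Z t w|)%:E)%E @[n --> \oo] -->
    (\int[P]_w (limn (fun n => (trunc_power n%:R p `|Z t w|)%:E)))%E.
  apply: cvg_monotone_convergence => //.
  - move=> w _ a b ab; rewrite lee_fin /trunc_power ler_wpM2l ?exprn_ge0//.
    by rewrite le_min ge_min lexx /= ge_min ler_nat ab orbT.
have e w : limn (fun n => (trunc_power n%:R p `|Z t w|)%:E) = (`|Z t w| ^+ p.+1)%:E.
  apply/cvg_lim => //; apply: cvg_near_cst; near=> n.
  rewrite /trunc_power min_l ?exprSr//.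
  by near: n; exact: nbhs_infty_ger.
under eq_integral do rewrite -e.
rewrite -(cvg_lim _ h)//; apply: lime_le; first by apply/cvg_ex; eexists; exact: h.
by apply: nearW => n; rewrite GE// lee_fin Gb.
Unshelve. all: by end_near. Qed.

(** The integral of a nonnegative function is a supremum over simple functions
    below it, so monotonicity requires no measurability. It is applied to the
    supremum norm of a path, an uncountable supremum. *)
Lemma ge0_le_integral_nomeas (R : realType) d (T : measurableType d)
    (mu : {measure set T -> \bar R}) (f g : T -> \bar R) :
  (forall w, 0 <= f w)%E -> (forall w, f w <= g w)%E ->
  (\int[mu]_w f w <= \int[mu]_w g w)%E.
Proof.
move=> f0 fg; have g0 w : (0 <= g w)%E by exact: le_trans (f0 w) (fg w).
rewrite !ge0_integralTE//; apply: le_ereal_sup => _ [h hf <-].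
by exists h => // w; exact: le_trans (hf w) (fg w).
Qed.

Lemma le_sup_norm (R : realType) (f : R -> R) (t : R) :
  {within `[0, 1], continuous f} -> t \in `[0, 1] -> `|f t| <= sup_norm f.
Proof.
move=> cf t01; have cn : {within `[0, 1], continuous (fun s => `|f s|)}.
  by move=> s; apply: cvg_norm; exact: cf.
have [c c01 cmax] := EVT_max ler01 cn.
apply: sup_upper_bound; last by exists t.
split; first by exists `|f t|, t.
by exists `|f c| => _ [s s01 <-]; exact: cmax.
Qed.

(** Induction on the order. The contraction factor 2 / (b p + 1) is below 1 only
    from p = 2 on; the orders up to 2 come from the supremum norm. *)
Lemma bounded_moments (R : realType) d (T : measurableType d)
    (P : probability T R) (Z : R -> {RV P >-> R}) :
  continuous_process Z -> solves_rde Z ->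
  ('E_P[fun w => (sup_norm (path_of Z w) ^+ 2)%R] < +oo)%E ->
  has_bounded_moments Z.
Proof.
move=> cZ rZ sZ.
have [M2 hM2] : exists M : R, forall t, t \in `[0, 1] ->
    (\int[P]_w (`|Z t w| ^+ 2)%:E <= M%:E)%E.
  exists (fine ('E_P[fun w => (sup_norm (path_of Z w) ^+ 2)%R])) => t t01.
  have n0 w : 0 <= sup_norm (path_of Z w).
    exact: le_trans (normr_ge0 _) (le_sup_norm (cZ w) t01).
  rewrite fineK; last first.
    rewrite ge0_fin_numE//; apply: expectation_ge0 => w.
    by rewrite exprn_ge0.
  rewrite unlock; apply: ge0_le_integral_nomeas => w; rewrite lee_fin ?exprn_ge0//.
  rewrite lerXn2r ?nnegrE//.
  exact: le_sup_norm (cZ w) t01.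
have base : exists M : R, moments_le Z 2 M.
  have mn l t : measurable_fun setT (fun w => (`|Z t w| ^+ l)%:E).
    apply/measurable_EFinP; apply: measurable_funX.
    by apply: measurableT_comp => //; exact: normr_measurable.
  exists (1 + M2) => l t l2 t01.
  apply: (@le_trans _ _ (\int[P]_w (cst 1%:E w + (`|Z t w| ^+ 2)%:E))%E).
    apply: ge0_le_integral => //.
    - exact: emeasurable_funD.
    - move=> w _; rewrite /= -EFinD lee_fin.
      have x0 := normr_ge0 (Z t w); move: l2; case: l => [|[|[|]]]// _.
      + by rewrite expr0 lerDl exprn_ge0.
      + by rewrite expr1 expr2; have := sqr_ge0 (`|Z t w| - 1); rewrite expr2; nra.
      + by rewrite lerDr.
  rewrite ge0_integralD//.
  have -> : (\int[P]_w (cst 1%:E w) = 1%:E)%E.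
    exact: integral_probability_cst.
  by rewrite EFinD leeD2l// hM2.
elim=> [|p [M hM]].
  by have [M hM] := base; exists M => l t l0; apply: hM; rewrite (leq_trans l0).
have [p1|p1] := leqP p 1.
  by have [M' hM'] := base; exists M' => l t lp; apply: hM'; rewrite (leq_trans lp).
have [M' hM'] := moment_step cZ rZ p1 hM.
exists (Num.max M M') => l t; rewrite leq_eqVlt => /orP[/eqP ->|lp] t01.
  by apply: (le_trans (hM' t t01)); rewrite lee_fin le_max lexx orbT.
by apply: (le_trans (hM l t _ t01)) => //; rewrite lee_fin le_max lexx.
Qed.

Lemma integrable_moment (R : realType) d (T : measurableType d)
    (P : probability T R) (Z : R -> {RV P >-> R}) :
  has_bounded_moments Z ->
  forall l t, t \in `[0, 1] ->
    P.-integrable setT (fun w => (Z t w ^+ l)%:E) /\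
    P.-integrable setT (fun w => (`|Z t w| ^+ l)%:E).
Proof.
move=> hM l t t01; have [M /(_ l t (leqnn _) t01) ZM] := hM l.
have mZ : measurable_fun setT (Z t) by [].
have i1 : P.-integrable setT (fun w => (`|Z t w| ^+ l)%:E).
  apply/integrableP; split.
    apply/measurable_EFinP; apply: measurable_funX.
    by apply: measurableT_comp => //; exact: normr_measurable.
  under eq_integral do rewrite gee0_abs ?lee_fin ?exprn_ge0//.
  exact: le_lt_trans ZM (ltry M).
split => //; apply: le_integrable i1 => //.
  by apply/measurable_EFinP; exact: measurable_funX.
by move=> w _; rewrite /= lee_fin !normrX normr_id.
Qed.

(** * The moments of the limit *)

(** The integrand J is a function of U alone, the inner integral over V and the two
    copies being computed in closed form. *)
Lemma moment_rde (R : realType) d (T : measurableType d)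
    (P : probability T R) (Z : R -> {RV P >-> R}) (m : nat) (s : R) :
  continuous_process Z -> solves_rde Z -> s \in `[0, 1] ->
  (forall l t, t \in `[0, 1] -> P.-integrable setT (fun w => (Z t w ^+ l)%:E)) ->
  let J := (fun u : measurableTypeR R => ((rde_scale s u `^ beta_exp R) ^+ m *
    mixed_moment_sum (fun l => fun_moment Z id l (rde_time s u)) m)%:E) in
  (uniform_prob (@ltr01 R)).-integrable setT J /\
  ((fun_moment Z id m s)%:E = \int[uniform_prob (@ltr01 R)]_u J u)%E.
Proof.
move=> cZ rZ s01 iZ J.
have mX : measurable_fun setT (fun x : R => (x ^+ m)%:E).
  by apply/measurable_EFinP; apply: measurable_funX.
have [iG GE] := integral_rde cZ rZ s01 mX (iZ m s s01).
have JE : (fun u => (\int[rde_inner_law Z]_y (rde_map s (u, y) ^+ m)%:E)%E) = J.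
  apply/funext => u.
  exact: (integral_inner_exprn (rde_scale s u `^ beta_exp R) m cZ (rde_time01 u s01)
    (@measurable_id _ _ setT) (fun l => iZ l _ (rde_time01 u s01))).
have iJ := integral_rde_law_integrable iG.
have EJ := integral_rde_law iG.
rewrite JE in iJ; split => //.
rewrite /fun_moment fineK; last exact: integrable_fin_num (iZ m s s01).
by rewrite [LHS]GE [LHS]EJ -JE.
Qed.

Definition rec_rhs (R : realType) (c : nat -> R) (m : nat) : R :=
  (beta_exp R * m%:R + 1)
    / ((m%:R - 1) * (m%:R + 1 - 3 / 2 * beta_exp R * m%:R))
  * \sum_(1 <= l < m)
      'C(m, l)%:R
      * Beta (beta_exp R * l%:R + 1) (beta_exp R * (m - l)%:R + 1)
      * c l * c (m - l)%N.

Lemma rec_denom_gt0 (R : realType) (m : nat) : (1 < m)%N ->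
  0 < (m%:R - 1) * (m%:R + 1 - 3 / 2 * beta_exp R * m%:R) :> R.
Proof.
move=> m1; have m2 : 2 <= m%:R :> R by rewrite ler_nat.
have /andP[b0 b1] := beta_exp_bounds R.
by apply: mulr_gt0; [lra|nra].
Qed.

(** Solving for the fixed point divides by (b m / 2 + 1) (b m + 1) - 2, which is
    (m - 1) (m + 1 - 3 b m / 2) because b^2 + 3 b = 2. *)
Lemma rec_rhs_fixpoint (R : realType) (c : nat -> R) (m : nat) : (1 < m)%N ->
  (2 / (beta_exp R * m%:R + 1) * rec_rhs c m + \sum_(1 <= l < m)
      'C(m, l)%:R
      * Beta (beta_exp R * l%:R + 1) (beta_exp R * (m - l)%:R + 1)
      * c l * c (m - l)%N) / (beta_exp R * m%:R / 2 + 1) = rec_rhs c m.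
Proof.
move=> m1; rewrite /rec_rhs; set S := \sum_(1 <= l < m) _.
have d0 := @rec_denom_gt0 R m m1.
have /andP[b0 b1] := beta_exp_bounds R.
have m2 : 2 <= m%:R :> R by rewrite ler_nat.
have bm : 0 < beta_exp R * m%:R by rewrite mulr_gt0; lra.
have e : (beta_exp R * m%:R / 2 + 1) * (beta_exp R * m%:R + 1) - 2 =
   (m%:R - 1) * (m%:R + 1 - 3 / 2 * beta_exp R * m%:R).
  have r := beta_exp_root R; move: r; rewrite expr2; set b := beta_exp R => r.
  have -> : b * m%:R / 2 + 1 = (b * m%:R + 2) / 2 by field.
  have -> : (b * m%:R + 2) / 2 * (b * m%:R + 1) =
    (b * b * (m%:R * m%:R) + 3 * b * m%:R + 2) / 2 by field.
  have -> : b * b = 2 - 3 * b by lra.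
  by field.
rewrite -e in d0 *; move: d0 bm; set b := beta_exp R * m%:R => d0 bm.
field; apply/and3P; split; rewrite gt_eqF//; last 2 first.
- lra.
- lra.
have -> : (b + 2) * (b + 1) - 4 = 2 * ((b / 2 + 1) * (b + 1) - 2) by field.
lra.
Qed.

(** The difference of E Z(s)^m and the claimed value is bounded in s and is fixed
    by an operator of norm at most 2 / (b m + 1) < 1, so it vanishes. *)
Lemma moment_profile_step (R : realType) d (T : measurableType d)
    (P : probability T R) (Z : R -> {RV P >-> R}) (c : nat -> R) (m : nat) :
  continuous_process Z -> solves_rde Z ->
  has_bounded_moments Z ->
  (1 < m)%N ->
  (forall l t, (l < m)%N -> t \in `[0, 1] ->
    fun_moment Z id l t = c l * profile (beta_exp R / 2) t ^+ l) ->
  forall s, s \in `[0, 1] ->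
    fun_moment Z id m s = rec_rhs c m * profile (beta_exp R / 2) s ^+ m.
Proof.
move=> cZ rZ hM m1 cP s s01.
have iZ l t t01 := (@integrable_moment _ _ _ _ Z hM l t t01).1.
have /andP[b0 b1] := beta_exp_bounds R.
have m2 : 2 <= m%:R :> R by rewrite ler_nat.
pose h t := profile (beta_exp R / 2) t.
pose g t := fun_moment Z id m t.
pose r := rec_rhs c m.
pose k : R := 2 / (beta_exp R * m%:R + 1).
pose S : R := \sum_(1 <= l < m) 'C(m, l)%:R
   * Beta (beta_exp R * l%:R + 1) (beta_exp R * (m - l)%:R + 1) * c l * c (m - l)%N.
have mmsE t : t \in `[0, 1] ->
    mixed_moment_sum (fun l => fun_moment Z id l t) m = k * g t + S * h t ^+ m.
  move=> t01; rewrite mixed_moment_sumE ?(ltnW m1)// fun_moment0 mul1r; congr (_ + _).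
  rewrite /S mulr_suml; apply: eq_big_nat => l /andP[l0 lm].
  rewrite !cP// ?ltn_subrL ?l0 ?(ltnW m1)//.
  rewrite -[in RHS](subnKC (ltnW lm)) exprD subnKC ?(ltnW lm)// /h; ring.
pose delta t := g t - r * h t ^+ m.
have k0 : 0 <= k by rewrite divr_ge0// addr_ge0// mulr_ge0//; lra.
have k1 : k < 1 by rewrite /k ltr_pdivrMr; nra.
(* Subtracting the fixed point rec_rhs c m * h^m cancels the inhomogeneous
   term S * h^m. *)
have deltaE t : t \in `[0, 1] ->
    (delta t)%:E = (\int[uniform_prob (@ltr01 R)]_u
      ((rde_scale t u `^ beta_exp R) ^+ m * (k * delta (rde_time t u)))%:E)%E /\
    (uniform_prob (@ltr01 R)).-integrable setT (fun u =>
      ((rde_scale t u `^ beta_exp R) ^+ m * (k * delta (rde_time t u)))%:E).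
  move=> t01.
  have [iJ JE] := moment_rde m cZ rZ t01 iZ.
  have [iK KE] := integral_rde_profileX (k * r + S) (ltnW m1) t01.
  have E : (fun u => ((rde_scale t u `^ beta_exp R) ^+ m * (k * delta (rde_time t u)))%:E) =
     (fun u : measurableTypeR R => ((rde_scale t u `^ beta_exp R) ^+ m *
    mixed_moment_sum (fun l => fun_moment Z id l (rde_time t u)) m)%:E -
     ((rde_scale t u `^ beta_exp R) ^+ m * ((k * r + S) *
       profile (beta_exp R / 2) (rde_time t u) ^+ m))%:E)%E.
    apply/funext => u; rewrite mmsE ?rde_time01// -EFinB; congr EFin.
    rewrite /delta /h; ring.
  rewrite E; split; last exact: integrableB.
  rewrite integralB//= -JE KE -EFinB; congr EFin.
  have fp : (k * r + S) / (beta_exp R * m%:R / 2 + 1) = r by exact: rec_rhs_fixpoint.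
  by rewrite /delta; congr (_ - _); rewrite [RHS]mulrAC fp.
suff d0 : `|delta s| <= 0.
  by move: d0; rewrite normr_le0 subr_eq0 => /eqP.
rewrite -[X in _ <= X](mul0r (1 - k)^-1).
apply: (@contraction_bound _ [set t | t \in `[0, 1]] (fun t => `|delta t|)) => //=.
  have [M /(_ m _ (leqnn m)) hMm] := hM m.
  exists (M + `|r|) => t t01; rewrite (le_trans (ler_normB _ _))// lerD//.
    rewrite -lee_fin /g /fun_moment EFin_normr_Rintegral//; last exact: iZ.
    apply: le_trans (hMm t t01); apply: le_trans (le_abse_integral _ _ _) _ => //.
      exact: measurable_int (iZ m t t01).
    by under eq_integral do rewrite abse_EFin normrX.
  rewrite normrM ler_piMr// ger0_norm ?exprn_ge0 ?profile_ge0//.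
  by rewrite exprn_ile1 ?profile_ge0// profile_le1// divr_ge0//; lra.
move=> D hD t t01; rewrite addr0.
have [dE di] := deltaE t t01.
rewrite -lee_fin; apply: (@le_trans _ _ `|(delta t)%:E|%E) => //.
rewrite dE; apply: le_trans (le_abse_integral _ _ _) _ => //.
  exact: measurable_int di.
have D0 : 0 <= D by apply: le_trans (hD t t01).
have cE : (\int[uniform_prob (@ltr01 R)]_u (cst (k * D)%:E u) = (k * D)%:E)%E.
  exact: integral_probability_cst.
rewrite -cE; apply: ae_ge0_le_integral => //.
- by apply: measurableT_comp => //; exact: measurable_int di.
- by move=> u _; rewrite lee_fin mulr_ge0.
exists (~` `[0, 1]%classic); split.
- by apply: measurableC.
- have mI : measurable (`[0, 1]%classic : set (measurableTypeR R)) by [].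
  apply: (etrans (probability_setC (uniform_prob (@ltr01 R)) mI)).
  apply: (etrans (congr1 (fun x => 1 - x)%E (uniform_prob_unit R))).
  exact: subee.
- move=> u /= nu u01; apply: nu => _; rewrite lee_fin.
  have sc0 := rde_scale_ge0 u t01.
  rewrite normrM normrX [X in X ^+ m]ger0_norm ?powR_ge0//.
  rewrite [X in _ * X <= _]normrM (ger0_norm k0).
  rewrite -[leRHS]mul1r; apply: ler_pM.
  - by rewrite exprn_ge0 ?powR_ge0.
  - by rewrite mulr_ge0.
  - rewrite exprn_ile1 ?powR_ge0// powR_le1 ?sc0 ?rde_scale_le1//; lra.
  - by rewrite ler_wpM2l// hD// rde_time01.
Qed.

(** Strong induction on m. The constant c m is read off at s = 1/2, where the
    profile is positive. *)
Lemma moment_profile (R : realType) d (T : measurableType d)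
    (P : probability T R) (Z : R -> {RV P >-> R}) :
  continuous_process Z -> solves_rde Z ->
  has_bounded_moments Z ->
  (forall s : R, s \in `[0, 1] ->
       fun_moment Z id 1 s = profile (beta_exp R / 2) s) ->
  exists c : nat -> R, [/\ c 0%N = 1, c 1%N = 1,
    (forall m, (1 < m)%N -> c m = rec_rhs c m) &
    forall m s, s \in `[0, 1] ->
      fun_moment Z id m s = c m * profile (beta_exp R / 2) s ^+ m].
Proof.
move=> cZ rZ hM m1.
have h12 : 1 / 2 \in `[0, 1 : R] by rewrite in_itv/=; apply/andP; split; lra.
pose q := profile (beta_exp R / 2) (1 / 2 : R).
have q0 : q != 0.
  rewrite /q /profile gt_eqF// powR_gt0//; lra.
pose c m := fun_moment Z id m (1 / 2) / q ^+ m.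
have key m : forall s, s \in `[0, 1] ->
    fun_moment Z id m s = c m * profile (beta_exp R / 2) s ^+ m /\
    ((1 < m)%N -> c m = rec_rhs c m).
  elim/ltn_ind: m => m IH s s01.
  case: m IH => [|[|m]] IH.
  - by rewrite fun_moment0 /c fun_moment0 !expr0 divr1 mulr1.
  - by split => //; rewrite m1// /c (m1 _ h12) -/q !expr1 divff// mul1r.
  have st := @moment_profile_step _ _ _ _ Z c m.+2 cZ rZ hM isT
    (fun l t lm t01 => (IH l lm t t01).1).
  have cE : c m.+2 = rec_rhs c m.+2 by rewrite {1}/c st// -/q mulfK// expf_neq0.
  by rewrite cE; split => //; exact: st.
exists c; split.
- by rewrite /c fun_moment0 expr0 divr1.
- by rewrite /c (m1 _ h12) -/q expr1 divff.
- by move=> m hm; exact: (key m _ h12).2 hm.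
- by move=> m s s01; exact: (key m s s01).1.
Qed.

(** * Growth of the moments *)

Lemma binomial_weight_le1 (R : realType) (m l : nat) (x : R) : (l <= m)%N ->
  0 <= x <= 1 -> 'C(m, l)%:R * (x ^+ l * (1 - x) ^+ (m - l)) <= 1.
Proof.
move=> lm /andP[x0 x1].
have e : (1 - x + x) ^+ m = 1 by rewrite subrK expr1n.
rewrite -[leRHS]e.
rewrite [leRHS]exprDn (bigD1 (Ordinal (lm : (l < m.+1)%N)))//=.
rewrite [x ^+ l * _]mulrC mulr_natl lerDl; apply: sumr_ge0 => i _.
by rewrite mulrn_wge0// mulr_ge0// exprn_ge0// subr_ge0.
Qed.

(** The integrand of the Beta value times C(m, l)^b is the b-th power of a binomial
    probability. *)
Lemma binomial_Beta_le1 (R : realType) (m l : nat) : (l <= m)%N ->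
  'C(m, l)%:R `^ beta_exp R *
    Beta (beta_exp R * l%:R + 1) (beta_exp R * (m - l)%:R + 1) <= 1.
Proof.
move=> lm; have b0 := beta_exp_ge0 R.
have C0 : 0 < 'C(m, l)%:R :> R by rewrite ltr0n bin_gt0.
have Cb0 : 0 < 'C(m, l)%:R `^ beta_exp R by rewrite powR_gt0.
pose k (x : R) := x `^ (beta_exp R * l%:R) * (1 - x) `^ (beta_exp R * (m - l)%:R).
have kle x : 0 <= x <= 1 -> k x <= ('C(m, l)%:R `^ beta_exp R)^-1.
  move=> /andP[x0 x1]; have x1' : 0 <= 1 - x by rewrite subr_ge0.
  have kx (y : R) (i : nat) : 0 <= y -> y `^ (beta_exp R * i%:R) = (y ^+ i) `^ beta_exp R.
    by move=> y0; rewrite mulrC powRrM powR_mulrn.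
  rewrite -[leRHS]mul1r ler_pdivlMr// /k !kx//.
  rewrite -!powRM ?mulr_ge0 ?exprn_ge0 ?ler0n// mulrC.
  apply: powR_le1 => //; rewrite !mulr_ge0 ?exprn_ge0//=.
  by apply: binomial_weight_le1 => //; rewrite x0.
have [ik kE] := @Beta_uniform R (beta_exp R * l%:R) (beta_exp R * (m - l)%:R)
  (mulr_ge0 b0 (ler0n _ _)) (mulr_ge0 b0 (ler0n _ _)).
rewrite mulrC -ler_pdivlMr// div1r -lee_fin -kE integral_uniform; last 2 first.
- exact: measurable_int ik.
- by move=> x; rewrite lee_fin mulr_ge0 ?powR_ge0.
rewrite subr0 invr1 mul1e.
set c := (_ `^ _)^-1.
apply: (@le_trans _ _ (\int[lebesgue_measure]_(v in `[0%R, 1%R]) (cst c%:E v))%E).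
  apply: ge0_le_integral => //.
  - by move=> v _; rewrite lee_fin mulr_ge0 ?powR_ge0.
  - exact: measurable_funTS (measurable_int _ ik).
by rewrite integral_cst//= lebesgue_measure_itv/= lte_fin ltr01 oppr0 adde0 mule1.
Qed.

(** The ratio (b N + 1) / (N + 1 - 3 b N / 2) is at most 10 for 1/2 < b < 3/5; this
    is where the constant of the growth bound comes from. *)
Lemma rec_prefactor_le (R : realType) (b N X Y : R) :
  1 / 2 < b -> b < 3 / 5 -> 2 <= N -> 0 <= X -> 0 <= Y ->
  (b * N + 1) / ((N - 1) * (N + 1 - 3 / 2 * b * N)) *
    ((N - 1) * (1 / 100 * X * Y)) <= 1 / 10 * X * Y.
Proof.
move=> b0 b1 N2 X0 Y0; have D0 : 0 < N - 1 by lra.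
have h : 0 <= N * (3 / 5 - b) by rewrite mulr_ge0; lra.
have E0 : 0 < N + 1 - 3 / 2 * b * N by nra.
set D := N - 1 in D0 *; set E := N + 1 - _ in E0 *.
have -> : (b * N + 1) / (D * E) * (D * (1 / 100 * X * Y)) =
   (b * N + 1) / (10 * E) * (1 / 10 * X * Y) by field; rewrite !gt_eqF.
rewrite ler_piMl ?mulr_ge0// ler_pdivrMr ?mulr_gt0// mul1r /E; nra.
Qed.

(** Write C(m, l) = C(m, l)^b C(m, l)^(1-b). The first factor absorbs the Beta value
    and the second turns (l!)^(1-b) ((m-l)!)^(1-b) into (m!)^(1-b). The m - 1 terms
    of the sum are compensated by the factor m - 1 in the denominator. *)
Lemma rec_growth (R : realType) (c : nat -> R) : c 1%N = 1 ->
  (forall m, (1 < m)%N -> c m = rec_rhs c m) ->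
  forall m, (0 < m)%N ->
    0 <= c m <= 1 / 10 * 10 ^+ m * (m`!)%:R `^ (1 - beta_exp R).
Proof.
move=> c1 cr; have /andP[b0 b1] := beta_exp_bounds R.
elim/ltn_ind => -[//|[|m]] IH _.
  by rewrite c1 expr1 powR1 mulr1 divfK// ler01 lexx.
set n := m.+2; pose F k : R := k`!%:R `^ (1 - beta_exp R).
have F0 k : 0 < F k by rewrite powR_gt0// ltr0n fact_gt0.
have n2 : 2 <= n%:R :> R by rewrite ler_nat.
have term l : (1 <= l < n)%N -> 0 <= 'C(n, l)%:R
      * Beta (beta_exp R * l%:R + 1) (beta_exp R * (n - l)%:R + 1)
      * c l * c (n - l)%N <= 1 / 100 * 10 ^+ n * F n.
  move=> /andP[l0 ln].
  have nl0 : (0 < n - l)%N by rewrite subn_gt0.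
  have nln : (n - l < n)%N by rewrite ltn_subrL l0.
  have /andP[cl0 cl] := IH l ln l0; have /andP[cn0 cn] := IH (n - l)%N nln nl0.
  have C0 : 0 < 'C(n, l)%:R :> R by rewrite ltr0n bin_gt0 ltnW.
  have B0 := Beta_ge0 (beta_exp R * l%:R + 1) (beta_exp R * (n - l)%:R + 1).
  rewrite !mulr_ge0//= ?(ltW C0)//.
  have BC := @binomial_Beta_le1 R n l (ltnW ln).
  have CE : 'C(n, l)%:R = 'C(n, l)%:R `^ beta_exp R * 'C(n, l)%:R `^ (1 - beta_exp R) :> R.
    by rewrite -powRD ?(gt_eqF C0) ?implybT// addrC subrK powRr1// ltW.
  have FE : 'C(n, l)%:R `^ (1 - beta_exp R) * (F l * F (n - l)%N) = F n.
    rewrite /F -powRM// -powRM ?mulr_ge0// -!natrM.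
    by rewrite bin_fact// ltnW.
  rewrite -mulrA.
  apply: (@le_trans _ _ ('C(n, l)%:R * Beta (beta_exp R * l%:R + 1) (beta_exp R * (n - l)%:R + 1)
     * ((1 / 10 * 10 ^+ l * F l) * (1 / 10 * 10 ^+ (n - l) * F (n - l)%N)))).
    by rewrite ler_wpM2l ?mulr_ge0 ?(ltW C0)// ler_pM.
  have -> : 10 ^+ n = 10 ^+ l * 10 ^+ (n - l) :> R by rewrite -exprD subnKC// ltnW.
  rewrite -FE {1}CE.
  set X := _ `^ beta_exp R in BC CE *; set Y := _ `^ (1 - beta_exp R).
  set B := Beta _ _ in B0 BC *.
  have -> : X * Y * B * (1 / 10 * 10 ^+ l * F l * (1 / 10 * 10 ^+ (n - l) * F (n - l)%N)) =
    X * B * (1 / 100 * (10 ^+ l * 10 ^+ (n - l)) * (Y * (F l * F (n - l)%N))) by field.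
  by rewrite ler_piMl// !mulr_ge0// ?exprn_ge0 ?ltW// ?powR_gt0.
have d0 := @rec_denom_gt0 R n isT.
rewrite cr// /rec_rhs -/n.
have S0 : 0 <= \sum_(1 <= l < n) 'C(n, l)%:R
      * Beta (beta_exp R * l%:R + 1) (beta_exp R * (n - l)%:R + 1)
      * c l * c (n - l)%N.
  by rewrite big_nat; apply: sumr_ge0 => l /term/andP[].
have Sle : \sum_(1 <= l < n) 'C(n, l)%:R
      * Beta (beta_exp R * l%:R + 1) (beta_exp R * (n - l)%:R + 1)
      * c l * c (n - l)%N <= (n%:R - 1) * (1 / 100 * 10 ^+ n * F n).
  rewrite big_nat; apply: (@le_trans _ _ (\sum_(1 <= l < n) (1 / 100 * 10 ^+ n * F n))).
    by rewrite [leRHS]big_nat; apply: ler_sum => l /term/andP[].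
  by rewrite sumr_const_nat -[leLHS]mulr_natl natrB.
have bn : 0 < beta_exp R * n%:R + 1 by nra.
rewrite mulr_ge0 ?divr_ge0 ?(ltW d0) ?(ltW bn)//=.
apply: le_trans (ler_wpM2l _ Sle) _; first by rewrite divr_ge0 ?(ltW d0) ?(ltW bn).
by apply: rec_prefactor_le => //; rewrite ?exprn_ge0 ?(ltW (F0 _)).
Qed.

Lemma sum_half_le (R : realType) (n : nat) :
  \sum_(0 <= j < n) (1 / 2) ^+ j <= 2 :> R.
Proof.
have -> : \sum_(0 <= j < n) (1 / 2) ^+ j = 2 - 2 * (1 / 2) ^+ n :> R.
  elim: n => [|n IH]; first by rewrite big_nil expr0 mulr1 subrr.
  by rewrite big_nat_recr//= IH exprS; field.
by rewrite gerBl mulr_ge0// exprn_ge0.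
Qed.

Lemma exprn_fact_le (R : realType) (x : R) (j : nat) : 0 <= x ->
  x ^+ j / j`!%:R <= expR x.
Proof.
move=> x0; have := series_exp_coeff_le x j.+1; rewrite (ger0_norm x0).
apply: le_trans; apply: le_trans (ler_norm _).
rewrite /series/= big_nat_recr//= lerDr; apply: sumr_ge0 => i _.
by rewrite /exp_coeff/= divr_ge0// exprn_ge0.
Qed.

Lemma fact_double_le (j : nat) : (j.*2`! <= 4 ^ j * (j`! * j`!))%N.
Proof.
have := bin_fact (leq_addr j j); rewrite addnn => <-.
rewrite -{2}addnn addnK leq_mul2r; apply/orP; right.
have jj : (j < j.*2.+1)%N by rewrite ltnS -addnn leq_addr.
rewrite -[4%N]/((1 + 1) ^ 2)%N -expnM mul2n expnDn (bigD1 (Ordinal jj))//=.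
by rewrite !exp1n !muln1 leq_addr.
Qed.

(** Up to a geometric factor, (2 j)!^(1-b) is at most (j!)^(2 - 2 b). As
    2 - 2 b < 1, dividing by j! leaves a negative power of j!, which beats every
    geometric growth. *)
Lemma gauss_criterion (R : realType) (c : nat -> R) : c 0%N = 1 ->
  (forall m, (0 < m)%N ->
    0 <= c m <= 1 / 10 * 10 ^+ m * (m`!)%:R `^ (1 - beta_exp R)) ->
  forall a : R, 0 <= a -> exists B, forall n,
     \sum_(0 <= j < n) a ^+ j / j`!%:R * c j.*2 <= B.
Proof.
move=> c0 cP a a0; have /andP[b0 b1] := beta_exp_bounds R.
(* After the bound on c and (2j)! <= 4^j (j!)^2, the j-th term is at most
   q^j / (j!)^delta. *)
pose delta := 2 * beta_exp R - 1; pose q : R := 4 * 10 ^+ 2 * a.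
have d0 : 0 < delta by rewrite /delta; lra.
have q0 : 0 <= q by apply: mulr_ge0 => //; apply: mulr_ge0 => //; exact: exprn_ge0.
pose Q := (2 * q) `^ delta^-1; pose E := expR Q `^ delta.
have Q0 : 0 <= Q by rewrite powR_ge0.
have E1 : 1 <= E.
  have e1 : 1 `^ delta = 1 :> R by rewrite powR1.
  rewrite -e1; apply: ge0_ler_powR; rewrite ?nnegrE ?expR_ge0 ?(ltW d0)//.
  by rewrite -expR0 ler_expR.
exists (E * 2) => n.
apply: (@le_trans _ _ (\sum_(0 <= j < n) E * (1 / 2) ^+ j)); last first.
  by rewrite -mulr_sumr ler_wpM2l ?sum_half_le// (le_trans _ E1).
apply: ler_sum => -[|j] _; first by rewrite !expr0 fact0 divr1 c0 !mulr1.
set k := j.+1.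
have /andP[ck0 ck] := cP k.*2 isT.
have kf0 : 0 < k`!%:R :> R by rewrite ltr0n fact_gt0.
(* The choice of Q turns Q^k / k! <= exp Q, raised to the power delta, into
   q^k / (k!)^delta <= E / 2^k. *)
have h1 : (2 * q) ^+ k <= E * k`!%:R `^ delta.
  have := exprn_fact_le k Q0; rewrite ler_pdivrMr// => h.
  have -> : (2 * q) ^+ k = (Q ^+ k) `^ delta.
    rewrite /Q powR_exprn -powRrM mulrAC mulVf ?gt_eqF// mul1r powR_mulrn//.
    by rewrite mulr_ge0.
  rewrite /E -powRM ?expR_ge0 ?ler0n//.
  by apply: ge0_ler_powR; rewrite ?nnegrE ?exprn_ge0 ?mulr_ge0 ?expR_ge0// ltW.
have h2 : (k.*2`!)%:R `^ (1 - beta_exp R) <= 4 ^+ k * (k`!%:R `^ (2 - 2 * beta_exp R)).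
  apply: (@le_trans _ _ ((4 ^+ k * (k`!%:R * k`!%:R)) `^ (1 - beta_exp R))).
    apply: ge0_ler_powR; rewrite ?nnegrE ?mulr_ge0 ?exprn_ge0 ?ler0n//; first lra.
    by rewrite -natrX -!natrM ler_nat fact_double_le.
  rewrite powRM ?exprn_ge0 ?mulr_ge0//.
  have -> : (k`!%:R * k`!%:R) `^ (1 - beta_exp R) = k`!%:R `^ (2 - 2 * beta_exp R).
    rewrite -expr2 -powR_mulrn ?ler0n// -powRrM; congr (_ `^ _); ring.
  rewrite ler_wpM2r ?powR_ge0//; apply: ler1_powR; last lra.
  by rewrite exprn_ege1// ler1n.
set f : R := k`!%:R in kf0 h1 h2 *; set G := f `^ delta in h1 *.
have G0 : 0 < G by rewrite powR_gt0.
have fG : f `^ (2 - 2 * beta_exp R) = f / G.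
  apply: (canRL (mulfK _)); first by rewrite gt_eqF.
  rewrite /G -powRD; last by rewrite (gt_eqF kf0) implybT.
  have -> : 2 - 2 * beta_exp R + delta = 1 by rewrite /delta; ring.
  by rewrite powRr1// ltW.
rewrite fG in h2.
have T0 : 0 <= 10 ^+ k.*2 :> R by rewrite exprn_ge0.
have ak0 : 0 <= a ^+ k / f by apply: divr_ge0; [exact: exprn_ge0|exact: ltW].
apply: (@le_trans _ _ (a ^+ k / f * (1 / 10 * 10 ^+ k.*2 * (4 ^+ k * (f / G))))).
  by rewrite ler_wpM2l// (le_trans ck)// ler_wpM2l// mulr_ge0.
have qk : q ^+ k = 4 ^+ k * 10 ^+ k.*2 * a ^+ k.
  by rewrite /q exprMn [(4 * _) ^+ _]exprMn -exprM mul2n.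
have hk : (1 / 2) ^+ k * (2 * q) ^+ k = q ^+ k.
  by rewrite -exprMn; congr (_ ^+ _); field.
have -> : a ^+ k / f * (1 / 10 * 10 ^+ k.*2 * (4 ^+ k * (f / G))) =
    1 / 10 * (q ^+ k / G).
  by rewrite qk; move: (10 ^+ k.*2) (4 ^+ k) (a ^+ k) => x y z; field; rewrite !gt_eqF.
have h3 : q ^+ k / G <= (1 / 2) ^+ k * E.
  by rewrite ler_pdivrMr// -hk -mulrA ler_wpM2l ?exprn_ge0.
have p0 : 0 <= q ^+ k / G by rewrite divr_ge0 ?exprn_ge0// ltW.
rewrite [leRHS]mulrC; lra.
Qed.

(** * Positivity of the limit *)

(** The right-hand side of the equation with both copies replaced by their absolute
    values: a majorant of the absolute value of the right-hand side. *)
Definition abs_rde_map (R : realType) (s : R) (z : rde_space R) : R :=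
  rde_comb s z.1 z.2.1 `|path_eval (rde_time s z.1) z.2.2.1|
     `|path_eval (rde_time s z.1) z.2.2.2|.

Lemma measurable_abs_rde_map (R : realType) (s : R) : s \in `[0, 1] ->
  measurable_fun setT (@abs_rde_map R s).
Proof.
move=> s01.
have mp := @measurable_powR R (beta_exp R).
have mX := measurable_rde_eval s01 measurable_fst.
have mY := measurable_rde_eval s01 measurable_snd.
have m1 : measurable_fun setT (fun z : rde_space R => z.2.1).
  exact: (measurableT_comp measurable_fst measurable_snd).
apply: measurable_funM.
  apply: (measurableT_comp mp).
  exact: (measurableT_comp (@measurable_rde_scale R s) measurable_fst).
apply: measurable_funD; apply: measurable_funM.
- exact: (measurableT_comp mp m1).
- exact: (measurableT_comp (@normr_measurable R setT) mX).
- apply: (measurableT_comp mp); apply: measurable_funB => //; exact: m1.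
- exact: (measurableT_comp (@normr_measurable R setT) mY).
Qed.

Lemma abs_rde_map_ge0 (R : realType) (s : R) z : 0 <= @abs_rde_map R s z.
Proof. by rewrite mulr_ge0 ?addr_ge0 ?mulr_ge0 ?powR_ge0. Qed.

Lemma ler_abs_rde_map (R : realType) (s : R) z :
  `|rde_map s z| <= @abs_rde_map R s z.
Proof.
rewrite /rde_map /abs_rde_map /rde_comb normrM ger0_norm ?powR_ge0//.
rewrite ler_wpM2l ?powR_ge0// (le_trans (ler_normD _ _))// !normrM.
by rewrite !(ger0_norm (powR_ge0 _ _)).
Qed.

Lemma abs_moment_rde (R : realType) d (T : measurableType d)
    (P : probability T R) (Z : R -> {RV P >-> R}) (m : nat) (s : R) :
  continuous_process Z -> s \in `[0, 1] ->
  (forall l t, t \in `[0, 1] -> P.-integrable setT (fun w => (`|Z t w| ^+ l)%:E)) ->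
  (\int[rde_law Z]_z (abs_rde_map s z ^+ m)%:E =
   \int[uniform_prob (@ltr01 R)]_u ((rde_scale s u `^ beta_exp R) ^+ m *
     mixed_moment_sum (fun l => fun_moment Z (fun x => `|x|) l (rde_time s u)) m)%:E)%E.
Proof.
move=> cZ s01 iZ.
pose G (z : rde_space R) := (abs_rde_map s z ^+ m)%:E.
have mG : measurable_fun setT G.
  by apply/measurable_EFinP; apply: measurable_funX; exact: measurable_abs_rde_map.
have G0 z : (0 <= G z)%E by rewrite lee_fin exprn_ge0// abs_rde_map_ge0.
have -> : (\int[rde_law Z]_z G z = \int[uniform_prob (@ltr01 R)]_u
    \int[rde_inner_law Z]_y G (u, y))%E.
  exact: (@fubini_tonelli1 _ _ _ _ R (uniform_prob (@ltr01 R)) (rde_inner_law Z)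
    G mG G0).
congr (integral _ _ _); apply/funext => u.
exact: (integral_inner_exprn (rde_scale s u `^ beta_exp R) m cZ (rde_time01 u s01)
  (@normr_measurable R setT) (fun l => iZ l _ (rde_time01 u s01))).
Qed.

Lemma eq_law_integral (R : realType) d1 (T1 : measurableType d1)
    (P1 : probability T1 R) (X : {RV P1 >-> R}) d2 (T2 : measurableType d2)
    (P2 : probability T2 R) (Y : {RV P2 >-> R}) (F : R -> \bar R) :
  eq_law (@measurable _ R) P1 X P2 Y ->
  measurable_fun setT F -> (forall x, 0 <= F x)%E ->
  (\int[P1]_w F (X w) = \int[P2]_w F (Y w))%E.
Proof.
move=> XY mF F0.
have <- := @ge0_integral_distribution _ _ _ _ _ P1 X F mF F0.
have <- := @ge0_integral_distribution _ _ _ _ _ P2 Y F mF F0.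
by apply: eq_measure_integral => A mA _; exact: XY.
Qed.

Lemma ae_eq_of_integral_eq (R : realType) d (T : measurableType d)
    (mu : {measure set T -> \bar R}) (f g : T -> R) :
  mu.-integrable setT (EFin \o f) -> mu.-integrable setT (EFin \o g) ->
  (forall w, f w <= g w) ->
  (\int[mu]_w (f w)%:E = \int[mu]_w (g w)%:E)%E ->
  ae_eq mu setT f g.
Proof.
move=> iF iG fg E.
have i0 : mu.-integrable setT (fun w => (g w - f w)%:E).
  by under eq_fun do rewrite EFinB; exact: integrableB.
have I0 : (\int[mu]_w `|(g w - f w)%:E| = 0)%E.
  under eq_integral => w _ do rewrite gee0_abs ?lee_fin ?subr_ge0//.
  under eq_integral do rewrite EFinB.
  by rewrite integralB// E subee//; exact: integrable_fin_num iG.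
have := (ae_eq_integral_abs mu measurableT (measurable_int _ i0)).1 I0.
apply: filterS => w /= h _; have := h I.
by move=> [/eqP]; rewrite subr_eq0 => /eqP ->.
Qed.

(** Ordered functions with the same finite integral agree almost everywhere. *)
Lemma integral_exprn_eq (R : realType) d (T : measurableType d)
    (mu : {measure set T -> \bar R}) (f g : T -> R) (m : nat) :
  mu.-integrable setT (EFin \o f) -> mu.-integrable setT (EFin \o g) ->
  (forall w, f w <= g w) ->
  (\int[mu]_w (f w)%:E = \int[mu]_w (g w)%:E)%E ->
  (\int[mu]_w (f w ^+ m)%:E = \int[mu]_w (g w ^+ m)%:E)%E.
Proof.
move=> iF iG fg E.
have mf : measurable_fun setT f by apply/measurable_EFinP; exact: measurable_int iF.
have mg : measurable_fun setT g by apply/measurable_EFinP; exact: measurable_int iG.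
apply: ae_eq_integral => //.
- by apply/measurable_EFinP; exact: measurable_funX.
- by apply/measurable_EFinP; exact: measurable_funX.
- have := ae_eq_of_integral_eq iF iG fg E.
  by apply: filterS => w /= h _; rewrite h.
Qed.

Definition rv_of (R : realType) d (T : measurableType d) (P : probability T R)
    (f : T -> R) (mf : measurable_fun setT f) : {RV P >-> R} :=
  mfun_Sub (mem_set mf).

(** Determinacy carries over from X to h X, because the criterion is required for
    every a. *)
Lemma law_profile (R : realType) d (T : measurableType d)
    (P : probability T R) (Z : R -> {RV P >-> R}) (c : nat -> R)
    (X : {RV P >-> R}) (t : R) :
  (forall l, P.-integrable setT (fun w => (Z t w ^+ l)%:E)) ->
  (forall m, fun_moment Z id m t = c m * profile (beta_exp R / 2) t ^+ m) ->
  (forall a : R, 0 <= a -> exists B, forall n,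
     \sum_(0 <= j < n) a ^+ j / j`!%:R * c j.*2 <= B) ->
  has_moments X -> (forall m, moment X m = c m) ->
  eq_law (@measurable _ R) P (Z t) P (fun w => profile (beta_exp R / 2) t * X w).
Proof.
move=> iZ ZE cB hX XE; set h := profile _ t.
have mhX : measurable_fun setT (fun w => h * X w) by exact: measurable_funM.
pose Y := rv_of P mhX.
have iY : has_moments Y.
  move=> m; rewrite /Y/=; under eq_fun do rewrite exprMn EFinM.
  exact: integrableZl.
have YE m : moment Y m = c m * h ^+ m.
  rewrite /moment unlock /Y/=; under eq_integral do rewrite exprMn EFinM.
  rewrite integralZl//.
  by rewrite integral_EFin_moment//= XE mulrC.
apply: (@moment_determinacy _ _ _ P Y _ _ P (Z t)) => //.
- by move=> m; rewrite YE -ZE /moment unlock.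
- move=> a a0; have [B hB] := cB (a * h ^+ 2) (mulr_ge0 a0 (sqr_ge0 _)).
  exists B => n; apply: le_trans (hB n); rewrite le_eqVlt; apply/orP; left; apply/eqP.
  apply: eq_bigr => j _; rewrite YE exprMn -exprM mul2n; ring.
Qed.

(** At s = 1/2 the recursion for the mean of |Z| is an equality, because the
    eigenvalue is 1. So the triangle inequality in the equation is an equality
    almost surely, and the recursion for the second moment holds for |Z| as well
    as for Z. The two differ only in the mixed term, which is proportional to e^2
    and to 1 respectively. *)
Lemma abs_moment_one (R : realType) d (T : measurableType d)
    (P : probability T R) (Z : R -> {RV P >-> R}) (c : nat -> R) (e : R) :
  continuous_process Z -> solves_rde Z ->
  (forall l t, t \in `[0, 1] ->
    P.-integrable setT (fun w => (Z t w ^+ l)%:E) /\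
    P.-integrable setT (fun w => (`|Z t w| ^+ l)%:E)) ->
  c 0%N = 1 -> c 1%N = 1 -> (forall m, (1 < m)%N -> c m = rec_rhs c m) ->
  0 < c 2%N -> 0 <= e ->
  (forall m t, t \in `[0, 1] ->
    fun_moment Z id m t = c m * profile (beta_exp R / 2) t ^+ m) ->
  (forall t, t \in `[0, 1] ->
    fun_moment Z (fun x => `|x|) 1 t = e * profile (beta_exp R / 2) t) ->
  e = 1.
Proof.
move=> cZ rZ iZ c0 c1 cr c2 e0 ZE ZabsE.
have /andP[b0 b1] := beta_exp_bounds R.
pose s : R := 1 / 2.
have s01 : s \in `[0, 1] by rewrite /s in_itv/=; apply/andP; split; lra.
pose h t := profile (beta_exp R / 2) t.
have h0 : 0 < h s by rewrite /h /profile /s powR_gt0//; lra.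
have iabs l t t01 := (iZ l t t01).2.
pose B := Beta (beta_exp R + 1) (beta_exp R + 1).
have BE : Beta (beta_exp R * 1%:R + 1) (beta_exp R * (2 - 1)%:R + 1) = B.
  by rewrite !mulr1.
pose k m : R := 2 / (beta_exp R * m%:R + 1).
have abs2 t : t \in `[0, 1] -> fun_moment Z (fun x => `|x|) 2 t = c 2%N * h t ^+ 2.
  move=> t01; rewrite -ZE// /fun_moment.
  by under eq_integral do rewrite /= -normrX ger0_norm ?sqr_ge0//.
(* The operator for m = 1 has eigenvalue 1, so the mean of the recursion
   applied to |Z| is exactly the mean of |Z s|. *)
have E1 : (\int[rde_law Z]_z (abs_rde_map s z)%:E = (e * h s)%:E)%E.
  have -> : (fun z => (abs_rde_map s z)%:E) = (fun z => (abs_rde_map s z ^+ 1)%:E).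
    by apply/funext => z; rewrite expr1.
  rewrite (abs_moment_rde 1 cZ s01 iabs).
  have [_ IE] := @integral_rde_profileX R 1 s (k 1%N * e) isT s01.
  have e1 : k 1%N * e * h s ^+ 1 / (beta_exp R * 1 / 2 + 1) = e * h s.
    rewrite /k !mulr1 expr1; have r := beta_exp_root R.
    have q : (beta_exp R + 1) * (beta_exp R / 2 + 1) = 2 by move: r; rewrite expr2; nra.
    have -> : 2 / (beta_exp R + 1) * e * h s / (beta_exp R / 2 + 1) =
      e * h s * (2 / ((beta_exp R + 1) * (beta_exp R / 2 + 1))).
      field; rewrite !gt_eqF//; lra.
    by rewrite q divff ?mulr1.
  rewrite -e1 -IE; apply: eq_integral => u _; congr EFin; congr (_ * _).
  by rewrite mixed_moment_sumE// big_geq// addr0 fun_moment0 mul1r ZabsE ?rde_time01// expr1 mulrA.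
have mabs := measurable_abs_rde_map s01.
have mmap := measurable_rde_map s01.
have iA : (rde_law Z).-integrable setT (EFin \o @abs_rde_map R s).
  apply/integrableP; split; first exact/measurable_EFinP.
  under eq_integral do rewrite gee0_abs ?lee_fin ?abs_rde_map_ge0//.
  by rewrite [X in (X < _)%E]E1; exact: ltry.
pose F (x : R) := `|x|%:E.
have mF : measurable_fun setT F by apply/measurable_EFinP; exact: normr_measurable.
have iFZ : P.-integrable setT (fun w => F (Z s w)) by have := iabs 1%N s s01.
have [iM EM] := integral_rde cZ rZ s01 mF iFZ.
have EMe : (\int[rde_law Z]_z `|rde_map s z|%:E = \int[rde_law Z]_z (abs_rde_map s z)%:E)%E.
  rewrite E1 -ZabsE// /fun_moment -[LHS]EM fineK//; exact: integrable_fin_num iFZ.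
(* Equality of the means forces equality in the triangle inequality, and thus
   of the second moments. *)
have sq := integral_exprn_eq 2 iM iA (@ler_abs_rde_map R s) EMe.
rewrite (abs_moment_rde 2 cZ s01 iabs) in sq.
have Esq : (\int[rde_law Z]_z (`|rde_map s z| ^+ 2)%:E = (c 2%N * h s ^+ 2)%:E)%E.
  have mF2 : measurable_fun setT (fun x : R => (`|x| ^+ 2)%:E).
    by apply/measurable_EFinP; apply: measurable_funX; exact: normr_measurable.
  have [_ EF2] := integral_rde cZ rZ s01 mF2 (iabs 2%N s s01).
  by rewrite -[LHS]EF2 -abs2// /fun_moment fineK//; exact: integrable_fin_num (iabs 2%N s s01).
have [_ IE] := @integral_rde_profileX R 2 s (k 2%N * c 2%N + 2 * B * e ^+ 2) isT s01.
have IE' : (\int[uniform_prob (@ltr01 R)]_u ((rde_scale s u `^ beta_exp R) ^+ 2 *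
     mixed_moment_sum (fun l => fun_moment Z (fun x => `|x|) l (rde_time s u)) 2)%:E =
   ((k 2%N * c 2%N + 2 * B * e ^+ 2) * h s ^+ 2 / (beta_exp R * 2 / 2 + 1))%:E)%E.
  rewrite -IE; apply: eq_integral => u _; congr EFin; congr (_ * _).
  rewrite mixed_moment_sumE// big_nat1 fun_moment0 mul1r.
  by rewrite !(ZabsE _ (rde_time01 u s01)) (abs2 _ (rde_time01 u s01)) /k BE binSn /h; ring.
rewrite Esq IE' in sq; move: sq => [sq].
have fp := rec_rhs_fixpoint c (isT : 1 < 2)%N.
rewrite -(cr 2%N isT) big_nat1 binSn BE c1 !mulr1 -/(k 2%N) in fp.
have H2 : h s ^+ 2 != 0 by rewrite expf_neq0// gt_eqF.
have dp : 0 < beta_exp R * 2 / 2 + 1 by clear -b0; lra.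
have d0 : beta_exp R * 2 / 2 + 1 != 0 by rewrite gt_eqF.
have sq' : (k 2%N * c 2%N + 2 * B * e ^+ 2) / (beta_exp R * 2 / 2 + 1) = c 2%N.
  by apply: (mulIf H2); rewrite sq; ring.
have k2 : k 2%N < 1 by rewrite /k; clear -b0; rewrite ltr_pdivrMr; lra.
have fp' : k 2%N * c 2%N + 2 * B = c 2%N * (beta_exp R * 2 / 2 + 1).
  by rewrite -[in RHS]fp divfK.
have sq2 : k 2%N * c 2%N + 2 * B * e ^+ 2 = c 2%N * (beta_exp R * 2 / 2 + 1).
  by rewrite -[in RHS]sq' divfK.
(* If B vanished, c 2 = k 2 * c 2 / (beta_exp R + 1) would force c 2 = 0. *)
have BB : B != 0.
  apply/eqP => B0; rewrite B0 mulr0 addr0 mulrC in fp'.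
  have := mulfI (lt0r_neq0 c2) fp'; move: (k 2%N) k2 => x; clear -b0; lra.
have e2 : e ^+ 2 = 1.
  apply: (mulfI BB); rewrite mulr1; move: fp' sq2.
  move: (k 2%N * c 2%N) (c 2%N * _) => x y; clear; move: B (e ^+ 2) => z t; lra.
by apply/eqP; rewrite -(@eqrXn2 _ 2)// e2 expr1n.
Qed.

Lemma sqr_moment_ge1 (R : realType) d (T : measurableType d)
    (P : probability T R) (X : {RV P >-> R}) :
  has_moments X -> moment X 1 = 1 -> 1 <= moment X 2.
Proof.
move=> hX X1.
have : (0 <= \int[P]_w (X w ^+ 2 - 2 * X w ^+ 1 + 1)%:E)%E.
  apply: integral_ge0 => w _; rewrite lee_fin.
  by have := sqr_ge0 (X w - 1); rewrite sqrrB1 expr1 mulr2n; lra.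
under eq_integral do rewrite EFinD EFinB [X in (_ - X + _)%E]EFinM.
have i1 : P.-integrable setT (fun w => (2%:E * (X w ^+ 1)%:E)%E).
  by apply: (integrableZl measurableT _ (hX 1%N)).
rewrite integralD//; last 2 first.
- by apply: integrableB => //; exact: hX.
- exact: finite_measure_integrable_cst.
rewrite integralB// integralZl//.
have -> : (\int[P]_x 1%:E = 1)%E.
  exact: integral_probability_cst.
rewrite !integral_EFin_moment// X1 -!EFinM -EFinB -EFinD lee_fin; lra.
Qed.

Lemma abs_law_profile (R : realType) d (T : measurableType d)
    (P : probability T R) (Z : R -> {RV P >-> R}) (X : {RV P >-> R}) (t : R) :
  P.-integrable setT (fun w => `|X w|%:E) ->
  eq_law (@measurable _ R) P (Z t) P (fun w => profile (beta_exp R / 2) t * X w) ->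
  fun_moment Z (fun x => `|x|) 1 t =
    fine (\int[P]_w `|X w|%:E)%E * profile (beta_exp R / 2) t.
Proof.
move=> iX law; set h := profile _ t in law *.
have mhX : measurable_fun setT (fun w => h * X w) by exact: measurable_funM.
have mF : measurable_fun setT (fun x : R => `|x|%:E).
  by apply/measurable_EFinP; exact: normr_measurable.
have := @eq_law_integral _ _ _ P (Z t) _ _ P (rv_of P mhX) (fun x => `|x|%:E) law mF.
move=> /(_ (fun x => normr_ge0 x)) E.
rewrite /fun_moment; under eq_integral do rewrite expr1.
rewrite E /=; under eq_integral do rewrite normrM (ger0_norm (profile_ge0 _ _)) EFinM.
rewrite ge0_integralZl ?lee_fin ?profile_ge0//; last exact: measurable_int iX.
have -> : (\int[P]_w `|X w|%:E = (fine (\int[P]_w `|X w|%:E))%:E)%E.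
  by rewrite fineK//; exact: integrable_fin_num iX.
by rewrite -EFinM /= mulrC.
Qed.

Theorem theorem6 (R : realType) (d : measure_display) (T : measurableType d)
    (P : probability T R) (Z : R -> {RV P >-> R})
    (Z_continuous : continuous_process Z)
    (Z_mean : forall s : R, s \in `[0, 1] ->
       ('E_P[Z s])%E = ((s * (1 - s)) `^ (beta_exp R / 2))%:E)
    (Z_square : ('E_P[fun w => (sup_norm (path_of Z w) ^+ 2)%R] < +oo)%E)
    (Z_rde : solves_rde Z) :
  exists (d' : measure_display) (T' : measurableType d')
    (P' : probability T' R) (Psi : {RV P' >-> R}),
    [/\ (forall w, 0 <= Psi w),
        (forall s : R, s \in `[0, 1] ->
           eq_law (@measurable _ R) P (Z s)
             P' (fun w => (s * (1 - s)) `^ (beta_exp R / 2) * Psi w)),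
        characterized_by_moments Psi,
        moment Psi 1 = 1
      & forall m : nat, (2 <= m)%N ->
          moment Psi m =
            (beta_exp R * m%:R + 1)
              / ((m%:R - 1) * (m%:R + 1 - 3 / 2 * beta_exp R * m%:R))
            * \sum_(1 <= l < m)
                'C(m, l)%:R
                * Beta (beta_exp R * l%:R + 1) (beta_exp R * (m - l)%:R + 1)
                * moment Psi l * moment Psi (m - l)].
Proof.
have hM := bounded_moments Z_continuous Z_rde Z_square.
have iZ := @integrable_moment _ _ _ _ Z hM.
have g1 (s : R) : s \in `[0, 1] ->
    fun_moment Z id 1 s = profile (beta_exp R / 2) s.
  move=> s01; have := Z_mean s s01; rewrite unlock /fun_moment => E.
  by under eq_integral do rewrite expr1; rewrite E.
have [c [c0 c1 cr cE]] := moment_profile Z_continuous Z_rde hM g1.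
have cB := gauss_criterion c0 (rec_growth c1 cr).
pose s : R := 1 / 2.
have s01 : s \in `[0, 1] by rewrite /s in_itv/=; apply/andP; split; lra.
pose q := profile (beta_exp R / 2) s.
have q0 : q != 0 by rewrite /q /profile /s gt_eqF// powR_gt0//; lra.
have mX : measurable_fun setT (fun w => q^-1 * Z s w) by exact: measurable_funM.
pose X := rv_of P mX.
have hX : has_moments X.
  move=> m; rewrite /X/=; under eq_fun do rewrite exprMn EFinM.
  by apply: (integrableZl measurableT _ (iZ m s s01).1).
have XE m : moment X m = c m.
  rewrite /moment unlock /X/=; under eq_integral do rewrite exprMn EFinM.
  rewrite integralZl//; last exact: (iZ m s s01).1.
  have -> : (\int[P]_w (Z s w ^+ m)%:E = (c m * q ^+ m)%:E)%E.
    rewrite -(cE m s s01) /fun_moment fineK//.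
    exact: integrable_fin_num (iZ m s s01).1.
  by rewrite -EFinM /= mulrC -mulrA -exprMn divff// expr1n mulr1.
have lawX t : t \in `[0, 1] ->
    eq_law (@measurable _ R) P (Z t) P (fun w => profile (beta_exp R / 2) t * X w).
  move=> t01; apply: law_profile cB hX XE => [l|m]; first exact: (iZ l t t01).1.
  exact: cE.
have iX : P.-integrable setT (EFin \o X).
  by have := hX 1%N; under eq_fun do rewrite expr1.
have iaX : P.-integrable setT (fun w => `|X w|%:E) by exact: integrable_norm iX.
pose e := fine (\int[P]_w `|X w|%:E)%E.
have e1 : e = 1.
  apply: (abs_moment_one Z_continuous Z_rde iZ c0 c1 cr _ _ cE).
  - by rewrite (lt_le_trans ltr01)// -XE sqr_moment_ge1// XE.
  - by apply: fine_ge0; apply: integral_ge0 => w _; rewrite lee_fin.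
  - by move=> t t01; apply: abs_law_profile => //; exact: lawX.
(* X <= |X| have the same mean, hence the same moments. *)
have EX : (\int[P]_w (X w)%:E = \int[P]_w `|X w|%:E)%E.
  rewrite -[RHS]fineK; last exact: integrable_fin_num iaX.
  by rewrite -/e e1 -c1 -XE -integral_EFin_moment.
have mPsi : measurable_fun setT (fun w => `|X w|).
  by apply: measurableT_comp => //; exact: normr_measurable.
pose Psi := rv_of P mPsi.
have hPsi : has_moments Psi.
  move=> m; rewrite /Psi/=; under eq_fun do rewrite -normrX.
  exact: integrable_norm (hX m).
have PsiE m : moment Psi m = c m.
  rewrite -XE /moment unlock; congr fine; apply/esym.
  by apply: integral_exprn_eq => // w; rewrite ler_norm.
exists d, T, P, Psi; split.
- by move=> w; rewrite /Psi/=.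
- move=> t t01; apply: law_profile cB hPsi PsiE => [l|m]; first exact: (iZ l t t01).1.
  exact: cE.
- split => // d' T' P' Y hY YE; apply: moment_determinacy => // a a0.
  by have [B hB] := cB a a0; exists B => n; under eq_bigr do rewrite PsiE.
- by rewrite PsiE.
- move=> m m2; rewrite PsiE cr//; congr (_ * _); apply: eq_bigr => l _.
  by rewrite !PsiE.
Qed.
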